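(* Suppose that the polynomials $g_1,\dots,g_{n_g}$ describing $\mathbf X$ satisfy the Archimedean condition: there exist $r\in\mathbb R$ and sums of squares of polynomials $\sigma_0,\dots,\sigma_{n_g}$ with $r^2-x^\top x=\sum_{i=0}^{n_g}\sigma_i g_i$ (where $g_0=1$). Suppose that the convex function $F$ is lower semicontinuous with respect to the product topology on $\mathbb R^{\infty}$. For each sufficiently large $k$ let $\mathbf y^k\in\mathbb R^{\binom{n+d_k}{d_k}}$ denote an optimal solution of the relaxation $(\mathrm R_k)$, and let $p^\star$ denote the optimal value of the infinite-dimensional problem $(\mathrm P)$ (both problems are defined in the context). Then: 1. $\lim_{k\to\infty}F(\mathbf y^k)=p^\star$. 2. There exists a subsequence $(k_i)_{i=1}^\infty$ such that $\mathbf y^{k_i}$ converges pointwise (i.e. for each $\alpha\in\mathbb N^n$ the entries $\mathbf y^{k_i}_\alpha$ converge as $i\to\infty$) to the moment sequence of an invariant measure $\mu^\star$ attaining the minimum in $(\mathrm P)$. 3. In particular, if there is a unique invariant measure $\mu^\star$ attaining the minimum in $(\mathrm P)$, then $\mathbf y^k$ converges pointwise to the moment sequence of $\mu^\star$.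
   Context: Let $T=(T_1,\dots,T_n):\mathbb R^n\to\mathbb R^n$ have polynomial components, with $\deg T:=\max_i\deg T_i\ge 1$. Let $\mathbf X=\{x\in\mathbb R^n: g_i(x)\ge 0,\ i=1,\dots,n_g\}$ be compact, with $g_i$ real multivariate polynomials, and set $g_0:=1$. An invariant measure (supported in $\mathbf X$) is a nonnegative Borel measure $\mu$ with support in $\mathbf X$ such that $\mu(T^{-1}(A))=\mu(A)$ for all Borel $A\subset\mathbb R^n$; in terms of moments this reads $\int_{\mathbf X} T(x)^\alpha\,d\mu(x)=\int_{\mathbf X} x^\alpha\,d\mu(x)$ for all $\alpha\in\mathbb N^n$, where $\mathbb N$ contains $0$, $x^\alpha=x_1^{\alpha_1}\cdots x_n^{\alpha_n}$ and $T^\alpha=T_1^{\alpha_1}\cdots T_n^{\alpha_n}$. $\mathbb R^\infty$ denotes the space of real sequences $\mathbf y=(\mathbf y_\alpha)_{\alpha\in\mathbb N^n}$. The moment sequence of a Borel measure $\mu$ on $\mathbf X$ is $\mathbf y_\alpha=\int_{\mathbf X}x^\alpha\,d\mu$, $\alpha\in\mathbb N^n$; it determines $\mu$ uniquely because $\mathbf X$ is compact. $\mathbf M(\mathbf X)\subset\mathbb R^\infty$ is the convex cone of moment sequences of nonnegative Borel measures on $\mathbf X$. For $\mathbf y$ (a sequence, or a vector indexed by $|\alpha|\le d$) the Riesz functional is $\ell^d_{\mathbf y}(f)=\sum_{|\alpha|\le d}f_\alpha\mathbf y_\alpha$ for polynomials $f=\sum_{|\alpha|\le d}f_\alpha x^\alpha$.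 The localizing matrix is $M_d(g_i\,\mathbf y)=\ell^d_{\mathbf y}(g_i v_{d_i}v_{d_i}^\top)$ (entrywise), where $d_i=\lfloor(d-\deg g_i)/2\rfloor$ and $v_m(x)=(x^\alpha)_{|\alpha|\le m}$; a constraint on $M_d(g_i\,\mathbf y)$ is imposed only if $\deg g_i\le d$. $F:\mathbb R^\infty\to\mathbb R\cup\{+\infty\}$ is a convex function depending only on finitely many of the coordinates $\mathbf y_\alpha$, so that $F(\mathbf y)$ is well defined for truncated sequences $\mathbf y$ of sufficiently high degree. Problem $(\mathrm P)$: minimize $F(\mathbf y)$ over $\mathbf y\in\mathbf M(\mathbf X)$ subject to $\mathbf y_0=1$ and $\int_{\mathbf X}T^\alpha\,d\mu=\int_{\mathbf X}x^\alpha\,d\mu$ for all $\alpha\in\mathbb N^n$ (which is a system of linear equations in the moments $\mathbf y$ of $\mu$). Thus the feasible $\mathbf y$ are exactly the moment sequences of invariant probability measures supported in $\mathbf X$, and a measure is said to attain the minimum in $(\mathrm P)$ if its moment sequence does. Problem $(\mathrm R_k)$ (relaxation of order $k$), with $d_k:=k\deg T$: minimize $F(\mathbf y)$ over $\mathbf y=(\mathbf y_\alpha)_{|\alpha|\le d_k}\in\mathbb R^{\binom{n+d_k}{d_k}}$ subject to $\ell^{d_k}_{\mathbf y}(T^\alpha)=\ell^{d_k}_{\mathbf y}(x^\alpha)$ for all $|\alpha|\le k$, $\mathbf y_0=1$, and $M_{d_k}(g_i\,\mathbf y)\succeq 0$ for $i=0,1,\dots,n_g$. *)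

(* Defs.v *)
(* The notations of mpoly.v clash with those of MathComp-Analysis, so only its
   names are imported: [mpoly n R] is the ring of polynomials in n variables,
   [multinom n] is N^n, and [bmultinom n b] is the finite type of the
   multi-indices of total degree < b. *)
From mathcomp Require Import all_boot all_order all_algebra.
From mathcomp Require Import all_classical all_reals all_analysis.
From mathcomp.multinomials Require Import -(notations) mpoly.

Set Implicit Arguments.
Unset Strict Implicit.
Unset Printing Implicit Defensive.

Import Order.TTheory GRing.Theory Num.Theory numFieldNormedType.Exports.

Local Open Scope classical_set_scope.
Local Open Scope ring_scope.

Notation borel_rV R n := (g_sigma_algebraType (@open 'rV[R]_n)).

(* R^oo with its product topology *)
Definition momseq (R : realType) (n : nat) :=
  prod_topology (fun _ : multinom n => R).

Definition truncseq (R : realType) (n d : nat) := bmultinom n d.+1 -> R.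

Section Polynomials.
Variables (R : realType) (n : nat).
Implicit Types (p : mpoly n R) (T : 'I_n -> mpoly n R).

(* The zero polynomial gets degree 0. *)
Definition pdeg p : nat := (mmeasure mdeg p).-1.

Definition map_deg T : nat := (\max_(i < n) pdeg (T i))%N.

Definition peval p (x : 'rV[R]_n) : R := meval (x ord0) p.

Definition map_eval T (x : 'rV[R]_n) : 'rV[R]_n := \row_i peval (T i) x.

Definition map_pow T (a : multinom n) : mpoly n R := \prod_(i < n) T i ^+ a i.

Definition is_sos p := exists s : seq (mpoly n R), p = \sum_(q <- s) q ^+ 2.

Definition psd_mx (m : nat) (A : 'M[R]_m) :=
  A^T = A /\ forall v : 'rV[R]_m, 0 <= (v *m A *m v^T) ord0 ord0.

End Polynomials.

Section Problem.
Variables (R : realType) (n ng : nat).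
Variables (T : 'I_n -> mpoly n R) (g : 'I_ng -> mpoly n R).
Variable F : momseq R n -> \bar R.
Implicit Types (mu : {measure set (borel_rV R n) -> \bar R}) (y : momseq R n).

Definition basic_set : set 'rV[R]_n := [set x | forall i, 0 <= peval (g i) x].

(* the family g_0 = 1, g_1, ..., g_ng *)
Definition constr (i : 'I_ng.+1) : mpoly n R := oapp g 1 (unlift ord0 i).

Definition is_archimedean :=
  exists (r : R) (sigma : 'I_ng.+1 -> mpoly n R),
    (forall i, is_sos (sigma i)) /\
    mpolyC n (r ^+ 2) - \sum_(i < n) mpolyX R (mnm1 i) ^+ 2 =
      \sum_(i < ng.+1) sigma i * constr i.

Definition msupport mu : set 'rV[R]_n :=
  [set x | forall U : set 'rV[R]_n, open U -> U x -> (0 < mu U)%E].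

Definition supported mu := msupport mu `<=` basic_set.

Definition invariant_measure mu :=
  supported mu /\
  forall A : set (borel_rV R n), measurable A ->
    mu (map_eval T @^-1` A) = mu A.

(* The equation takes place in the extended reals, so that the moments,
   in particular the total mass, are finite. *)
Definition is_moment_seq mu y :=
  forall a : multinom n,
    (y a)%:E = (\int[mu]_(x in basic_set) (peval (mpolyX R a) x)%:E)%E.

Definition moment_cone : set (momseq R n) :=
  [set y | exists mu, supported mu /\ is_moment_seq mu y].

(* The measure of a moment sequence is unique, so it does not matter that
   the invariance constraints are imposed on some representing measure. *)
Definition P_feasible : set (momseq R n) :=
  [set y | [/\ moment_cone y, y mnm0 = 1 &
    exists mu, [/\ supported mu, is_moment_seq mu y &
      forall a : multinom n,
        (\int[mu]_(x in basic_set) (peval (map_pow T a) x)%:E =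
         \int[mu]_(x in basic_set) (peval (mpolyX R a) x)%:E)%E]]].

(* +oo if the problem is infeasible *)
Definition P_value : \bar R := ereal_inf (F @` P_feasible).

Definition attains_P mu :=
  exists y, [/\ is_moment_seq mu y, P_feasible y & F y = P_value].

Section Truncated.
Variable d : nat.
Implicit Type z : truncseq R n d.

Definition riesz z (f : mpoly n R) : R :=
  \sum_(a : bmultinom n d.+1) mcoeff a f * z a.

Definition loc_deg (p : mpoly n R) : nat := ((d - pdeg p)./2)%N.

(* rows and columns are indexed by an enumeration of the |a| <= loc_deg p *)
Definition loc_mx (p : mpoly n R) z :
    'M[R]_(#|{: bmultinom n (loc_deg p).+1}|) :=
  \matrix_(a, b)
    riesz z (p * mpolyX R (bmnm (enum_val a)) * mpolyX R (bmnm (enum_val b))).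

(* Extension by 0; F does not depend on it once d is large. *)
Definition extend z : momseq R n :=
  fun a => oapp z 0 (insub a : option (bmultinom n d.+1)).

End Truncated.

Definition relax_deg (k : nat) : nat := (k * map_deg T)%N.

Definition R_feasible (k : nat) : set (truncseq R n (relax_deg k)) :=
  [set z | [/\ forall a : bmultinom n k.+1,
                 riesz z (map_pow T a) = riesz z (mpolyX R a),
               z bm0 = 1 &
               forall i : 'I_ng.+1, (pdeg (constr i) <= relax_deg k)%N ->
                 psd_mx (loc_mx (constr i) z)]].

Definition R_optimal (k : nat) (z : truncseq R n (relax_deg k)) :=
  R_feasible z /\
  forall w : truncseq R n (relax_deg k),
    R_feasible w -> (F (extend z) <= F (extend w))%E.

Definition finitely_determined :=
  exists s : seq (multinom n),
    forall y y', (forall a, a \in s -> y a = y' a) -> F y = F y'.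

Definition convex_on_momseq :=
  forall (t : R) y y', 0 < t < 1 ->
    (F (fun a => t * y a + (1 - t) * y' a)%R
       <= t%:E * F y + (1 - t)%:E * F y')%E.

End Problem.

Definition ptws_cvg (R : realType) (n : nat) (u : nat -> momseq R n)
    (y : momseq R n) :=
  forall a : multinom n, u k a @[k --> \oo] --> y a.

(* Main.v *)
Require Import Defs.
From HB Require Import structures.
From mathcomp Require Import all_boot all_order all_algebra.
From mathcomp Require Import all_classical all_reals all_analysis.
From mathcomp Require Import measurable_realfun ring lra.
From mathcomp.multinomials Require Import -(notations) mpoly.
Import Order.TTheory GRing.Theory Num.Theory numFieldNormedType.Exports.
Local Open Scope classical_set_scope.
Local Open Scope ring_scope.
Set Implicit Arguments.
Unset Strict Implicit.
Unset Printing Implicit Defensive.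

(** A feasible point of a relaxation is a linear functional, the Riesz functional,
    that is nonnegative on squares of bounded degree, also after multiplication by
    a constraint g_i. Multiplied by squares, the Archimedean identity shows that
    for large k the moments of these functionals are bounded by rho^|a|
    ([near_growth]). They therefore converge pointwise along every ultrafilter
    that refines the filter of cofinite sets of indices k. A limit L is a functional on all
    polynomials that satisfies the constraints of all relaxations, and it is the
    moment functional of an invariant measure on X
    ([moment_functional_measure]); so it is feasible for the moment problem. The
    truncations of a feasible point w of the moment problem are feasible for the
    relaxations ([truncation_feasible]), hence F (y k) <= F w for large k, and by
    lower semicontinuity the limit is optimal ([ultralimit_optimal]). As this
    holds for every ultrafilter, the values converge, and the points converge if
    the optimal measure is unique.

    The measure of L is built without the general representation theorems for
    positive functionals. By log-convexity, a functional that is nonnegative on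
    squares and of growth r^|a| is also nonnegative on all products of the
    polynomials r + X_i and r - X_i ([exponential_growth_moment]), so that, in the
    coordinates of the unit cube, the Bernstein polynomials have nonnegative
    values. These values are weights on a grid of mesh 1 / N whose moments tend
    to those of L ([hausdorff_moment]), and their limit along an ultrafilter is a
    finitely additive probability on the cube. Its values on dyadic cells are
    realized by nested subintervals of the unit interval, which yields a
    measurable map from the unit interval to the cube whose law under Lebesgue
    measure has the moments of L ([cube_representation]). The law lives on { g_i >= 0 } because L is
    nonnegative on g_i (1 - g_i / G)^2N for all N ([negative_part_null]). It is
    invariant because a bounded random vector is determined in law by its moments
    ([moments_determine_law]). *)

(** * Bernstein polynomials *)

Lemma dist_prod_le (R : realDomainType) (I : Type) (s : seq I) (A B : I -> R) :
  (forall i, 0 <= A i <= 1) -> (forall i, 0 <= B i <= 1) ->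
  `|\prod_(i <- s) A i - \prod_(i <- s) B i| <= \sum_(i <- s) `|A i - B i|.
Proof.
move=> A01 B01; elim: s => [|i s IHs]; first by rewrite !big_nil subrr normr0.
rewrite !big_cons.
have P01 (C : I -> R) : (forall i, 0 <= C i <= 1) ->
    0 <= \prod_(j <- s) C j <= 1.
  move=> C01; apply/andP; split; first by apply: prodr_ge0 => j _; case/andP: (C01 j).
  by apply: prodr_ile1 => j _; exact: C01.
set P := \prod_(j <- s) A j in IHs *; set Q := \prod_(j <- s) B j in IHs *.
have /andP[P0 P1] := P01 _ A01.
have /andP[b0 b1] := B01 i.
rewrite (_ : _ - _ = (A i - B i) * P + B i * (P - Q)); last by ring.
apply: (le_trans (ler_normD _ _)); rewrite !normrM (ger0_norm P0) (ger0_norm b0).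
apply: lerD; first by rewrite ler_piMr.
by apply: le_trans IHs; rewrite ler_piMl.
Qed.

Lemma dist_expr_le (R : realDomainType) (x y : R) (m : nat) :
  0 <= x <= 1 -> 0 <= y <= 1 -> `|x ^+ m - y ^+ m| <= m%:R * `|x - y|.
Proof.
move=> x01 y01.
have := @dist_prod_le R _ (iota 0 m) (fun=> x) (fun=> y) (fun=> x01) (fun=> y01).
by rewrite !big_const_seq !count_predT size_iota !iter_mulr_1 iter_addr_0 mulr_natl.
Qed.

Definition bernstein (A : comNzRingType) (N v : nat) (u : A) : A :=
  u ^+ v * (1 - u) ^+ (N - v) *+ 'C(N, v).

(** Falling factorials, unlike powers, have an exact Bernstein expansion: the
    coefficient v (v - 1) ... (v - j + 1) turns the binomial sum of order N into
    the one of order N - j, times u^j and the constant N^_j. *)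
Lemma bernstein_ffact (A : comNzRingType) (N j : nat) (u : A) : (j <= N)%N ->
  \sum_(v < N.+1) bernstein N v u *+ (v ^_ j) = u ^+ j *+ (N ^_ j).
Proof.
move=> /subnK <-; move: (N - j)%N => m {N}.
rewrite -(big_mkord xpredT (fun v => bernstein (m + j) v u *+ (v ^_ j))).
rewrite (@big_cat_nat _ _ _ j) //=; last by rewrite -addSn leq_addl.
rewrite big_nat big1 ?add0r; last first.
  by move=> i /andP[_ ij]; rewrite ffact_small.
rewrite -{1}[j]add0n big_addn -addSn addnK big_mkord.
have E (v : 'I_m.+1) : bernstein (m + j) (v + j) u *+ ((v + j) ^_ j)
    = u ^+ j * ((1 - u) ^+ (m - v) * u ^+ v *+ 'C(m, v)) *+ ((m + j) ^_ j).
  rewrite /bernstein subnDr -!mulrnA exprD mulrnAr -mulrnA.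
  rewrite -[(1 - u) ^+ _ * _]mulrC mulrA [u ^+ j * _]mulrC; congr (_ *+ _).
  have vm : (v <= m)%N by rewrite -ltnS.
  apply/eqP; rewrite -(@eqn_pmul2r (v`! * (m - v)`!)); last first.
    by rewrite muln_gt0 !fact_gt0.
  apply/eqP.
  have e1 : ('C(m, v) * (v`! * (m - v)`!) = m`!)%N by exact: bin_fact.
  have e2 : ('C(m + j, v + j) * ((v + j)`! * (m - v)`!) = (m + j)`!)%N.
    by rewrite -(subnDr j m v) bin_fact // leq_add2r.
  have e3 : ((v + j) ^_ j * v`! = (v + j)`!)%N.
    by rewrite -{2}[v : nat](addnK j) ffact_fact // leq_addl.
  have e4 : ((m + j) ^_ j * m`! = (m + j)`!)%N.
    by rewrite -{2}[m](addnK j) ffact_fact // leq_addl.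
  by rewrite [RHS]mulnAC e1 [(m`! * _)%N]mulnC e4 -e2 -e3 !mulnA.
rewrite (eq_bigr _ (fun v _ => E v)) sumrMnl -mulr_sumr; congr (_ *+ _).
by rewrite -exprDn subrK expr1n mulr1.
Qed.

Lemma ffact_ratio_bounds (R : realType) (N j : nat) (v : 'I_N.+1) : (j <= N)%N ->
  0 <= ((v ^_ j)%:R / (N ^_ j)%:R : R) <= 1.
Proof.
move=> jN; rewrite divr_ge0 //= ler_pdivrMr ?ltr0n ?ffact_gt0 // mul1r ler_nat.
rewrite !ffact_prod; apply: leq_prod => i _.
by apply: leq_sub2r; rewrite -ltnS.
Qed.

(** Up to O(1/N) the exact coefficients v^_j / N^_j are the values (v / N)^j of
    the monomial on the grid. *)
Lemma ffact_ratio_approx (R : realType) (N j : nat) (v : 'I_N.+1) : (j < N)%N ->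
  `|(v ^_ j)%:R / (N ^_ j)%:R - (v%:R / N%:R) ^+ j| <= (j ^ 2)%:R / (N - j)%:R :> R.
Proof.
move=> jN; have N0 : (0 < N)%N by apply: leq_ltn_trans jN.
have vN : (v <= N)%N by rewrite -ltnS.
have Nj0 : 0 < (N - j)%:R :> R by rewrite ltr0n subn_gt0.
have E : (v ^_ j)%:R / (N ^_ j)%:R = \prod_(i < j) ((v - i)%:R / (N - i)%:R) :> R.
  rewrite !ffact_prod !natr_prod prodf_div; congr (_ / _); by apply: eq_bigr.
have F : (v%:R / N%:R) ^+ j = \prod_(i < j) (v%:R / N%:R) :> R.
  by rewrite prodr_const card_ord.
rewrite E F.
have b01 (p q : nat) : (p <= q)%N -> 0 <= (p%:R / q%:R : R) <= 1.
  move=> pq; rewrite divr_ge0 //=; case: q pq => [|q] pq.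
    by rewrite invr0 mulr0 ler01.
  by rewrite ler_pdivrMr ?ltr0n // mul1r ler_nat.
apply: le_trans (dist_prod_le _ _ _) _.
- by move=> i; apply: b01; apply: leq_sub2r.
- by move=> i; apply: b01.
have G : (j ^ 2)%:R / (N - j)%:R = \sum_(i < j) (j%:R / (N - j)%:R) :> R.
  by rewrite sumr_const card_ord -mulnn natrM -mulrA mulr_natl.
rewrite G.
apply: ler_sum => i _.
have iN : (i < N)%N by apply: ltn_trans jN.
have Ni0 : 0 < (N - i)%:R :> R by rewrite ltr0n subn_gt0.
have NR : 0 < N%:R :> R by rewrite ltr0n.
have ij : (i <= j)%N by apply: ltnW.
have le1 : i%:R / (N - i)%:R <= j%:R / (N - j)%:R :> R.
  apply: ler_pM => //; do ?by rewrite invr_ge0 ltW.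
    by rewrite ler_nat.
  by rewrite lef_pV2 ?posrE // ler_nat leq_sub2l.
apply: le_trans le1.
have [vi|iv] := leqP v i.
  rewrite (eqP vi) mul0r sub0r normrN ger0_norm ?divr_ge0 //.
  apply: ler_pM => //; rewrite ?invr_ge0 ?ler_nat //.
  by rewrite lef_pV2 ?posrE // ler_nat leq_subr.
rewrite !natrB ?(ltnW iv) ?(ltnW iN) // in Ni0 *.
have -> : (v%:R - i%:R) / (N%:R - i%:R) - v%:R / N%:R
   = - ((i%:R / (N%:R - i%:R)) * ((N%:R - v%:R) / N%:R)) :> R.
  field; apply/andP; split; lra.
have q1 : 0 <= i%:R / (N%:R - i%:R) :> R by rewrite divr_ge0 // ltW.
have vN' : v%:R <= N%:R :> R by rewrite ler_nat.
have q2 : 0 <= (N%:R - v%:R) / N%:R :> R by rewrite divr_ge0 // subr_ge0.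
rewrite normrN normrM !ger0_norm // ler_piMr // ler_pdivrMr // mul1r gerBl.
exact: ler0n.
Qed.

(** * Ultrafilter limits *)

(** Limits along an ultrafilter play the role of diagonal subsequences: they exist
    for all bounded sequences at once and respect all linear relations. *)
Lemma ultra_bounded_cvg (R : realType) (T : Type) (U : set_system T)
    (f : T -> R) (M : R) : UltraFilter U ->
  (\forall x \near U, `|f x| <= M) -> exists l : R, f @ U --> l.
Proof.
move=> UU fM.
have fU : UltraFilter (f @ U).
  split; first exact: fmap_proper_filter.
  move=> G GG sUG; apply/seteqP; split => A; last exact: sUG.
  move=> GA; have [//|nA] := in_ultra_setVsetC (f @^-1` A) UU.
  have GnA : G (~` A) by apply: sUG.
  by have [x []] := filter_ex (filterI GA GnA).
have := @segment_compact R (- M) M; rewrite compact_ultra => /(_ _ fU).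
case; last by move=> l [_ fl]; exists l.
by apply: filterS fM => x /=; rewrite in_itv /= -ler_norml.
Qed.

(** * Binary subdivisions of the unit interval *)

Definition unit_measure (R : realType) :=
  mrestr (@lebesgue_measure R) (measurable_itv `[0%R, 1%R[).

Arguments unit_measure R : clear implicits.

HB.instance Definition _ (R : realType) :=
  measure_function.Measure.on (unit_measure R).

Lemma unit_measureT (R : realType) :
  unit_measure R [set: measurableTypeR R] = 1%E.
Proof.
rewrite /unit_measure /mrestr setTI lebesgue_measure_itv /= lte_fin ltr01.
by rewrite oppr0 addr0.
Qed.

Lemma unit_measure_lty (R : realType) :
  (unit_measure R [set: measurableTypeR R] < +oo)%E.
Proof. by rewrite unit_measureT ltry. Qed.

Section Subdivision.
Variables (R : realType) (p : seq bool -> R).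
Hypothesis p_ge0 : forall w, 0 <= p w.
Hypothesis p_nil : p [::] = 1.
Hypothesis p_split : forall w, p w = p (false :: w) + p (true :: w).

(** A word is a node of the infinite binary tree, with the most recent digit at
    the head. Its interval starts at left_end w and has length p w; the interval
    of the child false is the left part. *)
Fixpoint left_end (w : seq bool) : R :=
  if w is b :: w' then left_end w' + (if b then p (false :: w') else 0) else 0.

(** For t in the unit interval, the node of depth m whose interval contains t. The
    definition makes sense for every real t, so that functions of the path are
    measurable on the whole line. *)
Fixpoint path_of (t : R) (m : nat) : seq bool :=
  if m is m'.+1 then
    let w := path_of t m' in (left_end w + p (false :: w) <= t) :: w
  else [::].

Lemma size_path_of t m : size (path_of t m) = m.
Proof. by elim: m => //= m ->. Qed.

Lemma path_ofE t w : 0 <= t < 1 ->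
  (path_of t (size w) == w) = (left_end w <= t < left_end w + p w).
Proof.
move=> t01; elim: w => [|b w IHw] /=; first by rewrite p_nil add0r t01 eqxx.
rewrite eqseq_cons.
have [e|e] := eqVneq (path_of t (size w)) w; last first.
  rewrite andbF; symmetry; apply/negP => /andP[lt tl].
  move: IHw; rewrite (negbTE e) => /esym/negP; apply.
  have := p_ge0 (false :: w); have := p_ge0 (true :: w).
  move: tl lt; rewrite (p_split w).
  by case: b => ? ? ? ?; apply/andP; split; lra.
move: IHw; rewrite e eqxx andbT => /esym/andP[lt tl].
have := p_ge0 (false :: w); have := p_ge0 (true :: w); move: tl.
rewrite (p_split w); case: b => tl p1 p2; rewrite ?addr0.
  by rewrite addrA in tl; rewrite tl andbT; case: leP.
by rewrite lt /=; case: leP.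
Qed.

Lemma left_end_bounds w : 0 <= left_end w /\ left_end w + p w <= 1.
Proof.
elim: w => [|b w [IH1 IH2]] /=; first by rewrite p_nil add0r.
have := p_ge0 (false :: w); have := p_ge0 (true :: w).
by move: IH2; rewrite (p_split w); case: b => ? ? ?; split; lra.
Qed.

Lemma measurable_path_of m w :
  measurable [set t : measurableTypeR R | path_of t m = w].
Proof.
elim: m w => [|m IHm] w /=.
  have [->|w0] := eqVneq w [::].
    by rewrite (_ : [set _ | _] = setT) //; apply/seteqP; split.
  rewrite (_ : [set _ | _] = set0) //; apply/seteqP; split => // t /= e.
  by rewrite -e eqxx in w0.
case: w => [|b w].
  by rewrite (_ : [set _ | _] = set0) //; apply/seteqP; split.
rewrite (_ : [set _ | _] = [set t | path_of t m = w] `&`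
  (if b then `[left_end w + p (false :: w), +oo[%classic
        else `]-oo, left_end w + p (false :: w)[%classic)); last first.
  apply/seteqP; split => t /=.
    by move=> [<- ->]; split=> //; case: leP => /= h; rewrite in_itv /= ?andbT.
  by move=> [->]; case: b => /=; rewrite in_itv /= ?andbT; case: leP.
by apply: measurableI; first exact: IHm; case: b; exact: measurable_itv.
Qed.

Lemma unit_measure_path_of w :
  unit_measure R [set t | path_of t (size w) = w] = (p w)%:E.
Proof.
rewrite /unit_measure /mrestr.
have [l0 l1] := left_end_bounds w.
rewrite (_ : _ `&` _ = `[left_end w, left_end w + p w[%classic).
  rewrite lebesgue_measure_itv /= lte_fin ltrDl; case: ltP => [_|pw0].
    by rewrite -EFinD addrAC subrr add0r.
  by congr (_%:E); apply/eqP; rewrite eq_le p_ge0 pw0.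
apply/seteqP; split => t /=; rewrite !in_itv /=.
  by move=> [/eqP e t01]; rewrite -path_ofE.
move=> h; have t01 : 0 <= t < 1.
  by case/andP: h => ? ?; apply/andP; split; lra.
by split => //; apply/eqP; rewrite path_ofE.
Qed.

Lemma comp_path_ofE (phi : seq bool -> R) m :
  phi \o path_of ^~ m =
  (fun t => \sum_(w : m.-tuple bool) phi w * \1_[set t | path_of t m = w] t).
Proof.
apply/funext => t /=.
pose w := Tuple (introT eqP (size_path_of t m)).
rewrite (bigD1 w) //= big1 ?addr0; last first.
  move=> v vw; rewrite indicE memNset ?mulr0 //= => e; case/eqP: vw.
  by apply: val_inj; rewrite /= e.
by rewrite indicE mem_set ?mulr1.
Qed.

Lemma measurable_comp_path_of (phi : seq bool -> R) m :
  measurable_fun [set: measurableTypeR R] (phi \o path_of ^~ m).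
Proof.
rewrite comp_path_ofE.
apply: measurable_sum => w; apply: measurable_funM => //.
by apply: measurable_indic; exact: measurable_path_of.
Qed.

Lemma integral_path_of (phi : seq bool -> R) m :
  (\int[unit_measure R]_t (phi (path_of t m))%:E =
   (\sum_(w : m.-tuple bool) phi w * p w)%:E)%E.
Proof.
transitivity (\int[unit_measure R]_t
    (\sum_(w : m.-tuple bool) (phi w * \1_[set t | path_of t m = w] t)%:E))%E.
  apply: eq_integral => t _; rewrite sumEFin.
  by have /(congr1 (fun f => f t)) /= -> := comp_path_ofE phi m.
have mI (w : m.-tuple bool) : measurable [set t : measurableTypeR R | path_of t m = w].
  exact: measurable_path_of.
rewrite integral_sum //=; last first.
  move=> w; apply: measurable_bounded_integrable => //.
  - exact: unit_measure_lty.
  - by apply: measurable_funM => //; exact: measurable_indic.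
  - exists `|phi w|; split; first exact: num_real.
    move=> M M0 t _ /=; rewrite normrM indicE; apply: le_trans (ltW M0).
    by rewrite ler_piMr //; case: (_ \in _); rewrite ?normr1 ?normr0.
rewrite -sumEFin; apply: eq_bigr => w _.
under eq_integral do rewrite EFinM.
rewrite integralZl //; last first.
  apply: measurable_bounded_integrable => //.
  - exact: unit_measure_lty.
  - exists 1; split; first exact: num_real.
    move=> M M0 t _ /=; rewrite indicE; apply: le_trans (ltW M0).
    by case: (_ \in _); rewrite ?normr1 ?normr0.
rewrite integral_indic // setIT EFinM; congr (_ * _)%E.
by have := unit_measure_path_of w; rewrite size_tuple.
Qed.

End Subdivision.

(** * Positive functionals on the cube *)

Section Digits.
Variables (R : realType) (n' : nat).
Let n := n'.+1.

Definition unit_cube : set ('I_n -> R) := [set x | forall i, 0 <= x i <= 1].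

(** The part of x that follows its first k binary digits, rescaled to the unit
    interval. The digit is 1 as soon as the residue reaches 1/2, and so x = 1 has
    the expansion with all digits equal to 1. *)
Fixpoint residue (k : nat) (x : R) : R :=
  if k is k'.+1 then 2 * residue k' x - (2^-1 <= residue k' x)%R%:R else x.

Lemma residue_bounds k x : 0 <= x <= 1 -> 0 <= residue k x <= 1.
Proof.
move=> x01; elim: k => [|k IHk] /=; first exact: x01.
case/andP: IHk => ? ?.
by case: (leP 2^-1 (residue k x)) => /= ?; apply/andP; split; lra.
Qed.

(** The coordinates take turns to deliver their next digit, so that a single binary
    word describes a dyadic cell of the cube. *)
Definition schedule (m : nat) : 'I_n := inord (m %% n).

Fixpoint depth (m : nat) (i : 'I_n) : nat :=
  if m is m'.+1 then (depth m' i + (schedule m' == i))%N else 0.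

Fixpoint word (x : 'I_n -> R) (m : nat) : seq bool :=
  if m is m'.+1 then
    let i := schedule m' in (2^-1 <= residue (depth m' i) (x i)) :: word x m'
  else [::].

(** The lower corner of the cell described by a word. *)
Fixpoint value (w : seq bool) (i : 'I_n) : R :=
  if w is b :: w' then
    value w' i + (schedule (size w') == i)%:R * b%:R / 2 ^+ (depth (size w') i).+1
  else 0.

Lemma size_word x m : size (word x m) = m.
Proof. by elim: m => //= m ->. Qed.

Lemma value_word x m i :
  x i = value (word x m) i + residue (depth m i) (x i) / 2 ^+ depth m i.
Proof.
elim: m => [|m IHm] /=; first by rewrite add0r expr0 divr1.
rewrite size_word [LHS]IHm -addrA; congr (_ + _).
have [<-|_] := eqVneq (schedule m) i; last by rewrite addn0 !mul0r add0r.
rewrite addn1 /= exprS; set y := residue _ _; set b := (_ <= y).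
have p0 : (2 : R) ^+ depth m (schedule m) != 0 by rewrite expf_neq0.
by field.
Qed.

Lemma value_cons b w i : value w i <= value (b :: w) i /\
  value (b :: w) i + (2 ^+ depth (size w).+1 i)^-1
    <= value w i + (2 ^+ depth (size w) i)^-1.
Proof.
rewrite /=; set d := depth _ _.
have d0 : 0 <= ((2 : R) ^+ d)^-1 by rewrite invr_ge0 exprn_ge0.
case: eqVneq => _ /=; last by rewrite !mul0r addn0 addr0.
rewrite addn1 exprS invfM mul1r; set z := (_ ^+ d)^-1 in d0 *.
by case: b; rewrite ?mul0r ?mul1r ?addr0; split; lra.
Qed.

Lemma dist_value_word x m i : unit_cube x ->
  `|x i - value (word x m) i| <= (2 ^+ depth m i)^-1.
Proof.
move=> /(_ i) /(residue_bounds (depth m i)) /andP[r0 r1].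
have p0 : 0 < (2 : R) ^+ depth m i by rewrite exprn_gt0.
rewrite [x in x - _](value_word x m) addrAC subrr add0r ger0_norm.
  by rewrite ler_pdivrMr // mulVf ?gt_eqF.
by rewrite divr_ge0 // ltW.
Qed.

(** Every coordinate has its turn once in each block of n digits, hence the cells
    shrink to points. *)
Lemma depth_block k i : (k <= depth (n * k) i)%N.
Proof.
elim: k => // k IHk; rewrite mulnS addnC.
have mono a b : (depth a i <= depth (a + b) i)%N.
  elim: b => [|b IHb]; first by rewrite addn0.
  by rewrite addnS /=; apply: leq_trans IHb (leq_addr _ _).
have -> : (n * k + n = (n * k + i).+1 + (n - i.+1))%N.
  by rewrite -addnS -addnA subnKC.
apply: leq_trans (mono _ _); rewrite /=.
have -> : schedule (n * k + i) = i.
  by apply: val_inj; rewrite /= inordK ?ltn_pmod // mulnC modnMDl modn_small.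
by rewrite eqxx addn1 ltnS; apply: leq_trans IHk (mono _ _).
Qed.

(** The lower corners of nested cells increase to their common point. *)
Definition digit_limit (b : nat -> seq bool) (i : 'I_n) : R :=
  sup [set value (b m) i | m in setT].

Lemma digit_limitP (b : nat -> seq bool) i m :
  (forall k, size (b k) = k) -> (forall k, exists c, b k.+1 = c :: b k) ->
  value (b m) i <= digit_limit b i <= value (b m) i + (2 ^+ depth m i)^-1.
Proof.
move=> szb bS.
have up k l : value (b k) i <= value (b (k + l)%N) i.
  elim: l => [|l IHl]; first by rewrite addn0.
  rewrite addnS; have [c ->] := bS (k + l)%N.
  by apply: le_trans IHl _; have [] := value_cons c (b (k + l)%N) i.
have dn k l : value (b (k + l)%N) i + (2 ^+ depth (k + l) i)^-1
    <= value (b k) i + (2 ^+ depth k i)^-1.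
  elim: l => [|l IHl]; first by rewrite addn0.
  rewrite addnS; have [c ->] := bS (k + l)%N.
  by apply: le_trans IHl; have [_] := value_cons c (b (k + l)%N) i; rewrite szb.
have p0 k : 0 <= ((2 : R) ^+ depth k i)^-1 by rewrite invr_ge0 exprn_ge0.
have ub : ubound [set value (b k) i | k in setT]
    (value (b m) i + (2 ^+ depth m i)^-1).
  move=> _ [k _ <-]; have [mk|/ltnW km] := leqP m k.
    have := dn m (k - m)%N; rewrite subnKC //; apply: le_trans.
    by rewrite lerDl.
  apply: (@le_trans _ _ (value (b m) i)); last by rewrite lerDl.
  by have := up k (m - k)%N; rewrite subnKC.
apply/andP; split; last by apply: ge_sup => //; exists (value (b 0) i), 0.
by apply: ub_le_sup; [exists (value (b m) i + (2 ^+ depth m i)^-1)|exists m].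
Qed.

End Digits.

Lemma le_div_exp2_le0 (R : realType) (x c : R) :
  (forall k, x <= c / 2 ^+ k) -> x <= 0.
Proof.
move=> xc; rewrite leNgt; apply/negP => x0.
have c0 : 0 <= c by apply: le_trans (ltW x0) _; have := xc 0; rewrite expr0 divr1.
have := archi_boundP (divr_ge0 c0 (ltW x0)); set k := Num.bound _ => ck.
have := xc k; rewrite leNgt => /negP; apply.
rewrite ltr_pdivrMr ?exprn_gt0 // mulrC -ltr_pdivrMr //.
by apply: lt_trans ck _; rewrite -natrX ltr_nat ltn_expl.
Qed.

Lemma bounded_integrable d (T : measurableType d) (R : realType)
    (mu : {measure set T -> \bar R}) (f : T -> R) (M : R) :
  (mu setT < +oo)%E -> measurable_fun setT f -> (forall x, `|f x| <= M) ->
  mu.-integrable setT (EFin \o f).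
Proof.
move=> mufin mf fM; apply: measurable_bounded_integrable => //.
exists M; split; first exact: num_real.
by move=> N MN x _ /=; apply: le_trans (fM x) (ltW MN).
Qed.

Lemma dist_Rintegral_le d (T : measurableType d) (R : realType)
    (mu : {measure set T -> \bar R}) (f g : T -> R) (M e : R) :
  mu setT = 1%E -> measurable_fun setT f -> measurable_fun setT g ->
  (forall x, `|f x| <= M) -> (forall x, `|g x| <= M) ->
  (forall x, `|f x - g x| <= e) ->
  `|\int[mu]_x f x - \int[mu]_x g x| <= e.
Proof.
move=> mu1 mf mg fM gM fg.
have mufin : (mu setT < +oo)%E by rewrite mu1 ltry.
have If := bounded_integrable mufin mf fM.
have Ig := bounded_integrable mufin mg gM.
have mfg : measurable_fun setT (f \- g) by exact: measurable_funB.
have Ifg := bounded_integrable mufin mfg fg.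
rewrite -RintegralB //; apply: le_trans (le_normr_Rintegral _ _) _ => //.
have -> : e = \int[mu]_x (cst e) x by rewrite Rintegral_cst // mu1 mulr1.
apply: le_Rintegral => //.
- apply: (@bounded_integrable _ _ _ _ _ e) => //; first exact: measurableT_comp.
  by move=> x; rewrite /= normr_id.
- by apply: (@bounded_integrable _ _ _ _ _ `|e|).
Qed.

Section CubeRepresentation.
Variables (R : realType) (n' : nat).
Let n := n'.+1.

Definition cube_bounded (phi : ('I_n -> R) -> R) :=
  exists M, forall x, unit_cube x -> `|phi x| <= M.

Variable E : (('I_n -> R) -> R) -> R.
Hypothesis E_linear : forall c phi psi, cube_bounded phi -> cube_bounded psi ->
  E (fun x => c * phi x + psi x) = c * E phi + E psi.
Hypothesis E_ge0 : forall phi, cube_bounded phi ->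
  (forall x, unit_cube x -> 0 <= phi x) -> 0 <= E phi.
Hypothesis E1 : E (fun=> 1) = 1.

Lemma cube_bounded_cst c : cube_bounded (fun=> c).
Proof. by exists `|c|. Qed.

Lemma cube_bounded_lin c phi psi : cube_bounded phi -> cube_bounded psi ->
  cube_bounded (fun x => c * phi x + psi x).
Proof.
move=> [M bM] [N bN]; exists (`|c| * M + N) => x x01.
apply: le_trans (ler_normD _ _) _; rewrite normrM; apply: lerD; last exact: bN.
by rewrite ler_wpM2l // bM.
Qed.

Let E_cst c : E (fun=> c) = c.
Proof.
have E0 : E (fun=> 0) = 0.
  have := E_linear 1 (cube_bounded_cst 0) (cube_bounded_cst 0).
  rewrite (_ : (fun=> 1 * 0 + 0) = fun=> 0); last first.
    by apply/funext => x; rewrite mulr0 addr0.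
  by rewrite mul1r => e; lra.
have := E_linear c (cube_bounded_cst 1) (cube_bounded_cst 0).
rewrite (_ : (fun=> c * 1 + 0) = fun=> c); last first.
  by apply/funext => x; rewrite mulr1 addr0.
by rewrite E0 E1 mulr1 addr0.
Qed.

Let E_le phi psi : cube_bounded phi -> cube_bounded psi ->
  (forall x, unit_cube x -> phi x <= psi x) -> E phi <= E psi.
Proof.
move=> bp bq pq; rewrite -subr_ge0 addrC -mulN1r -E_linear //.
apply: E_ge0; first exact: cube_bounded_lin.
by move=> x x01; rewrite mulN1r addrC subr_ge0 pq.
Qed.

Let E_dist phi psi e : cube_bounded phi -> cube_bounded psi ->
  (forall x, unit_cube x -> `|phi x - psi x| <= e) -> `|E phi - E psi| <= e.
Proof.
move=> bp bq pq.
have shift (f g : ('I_n -> R) -> R) : cube_bounded f -> cube_bounded g ->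
    (forall x, unit_cube x -> `|f x - g x| <= e) -> E f - E g <= e.
  move=> bf bg fg; rewrite lerBlDr addrC -[E g]mul1r -(E_cst e) -E_linear //; last first.
    exact: cube_bounded_cst.
  apply: E_le => //; first by apply: cube_bounded_lin => //; exact: cube_bounded_cst.
  by move=> x /fg; rewrite mul1r ler_norml => /andP[_]; rewrite lerBlDr addrC.
rewrite ler_norml shift // andbT lerNl opprB shift //.
by move=> x /pq; rewrite distrC.
Qed.

Let E_sum (I : Type) (s : seq I) (c : I -> R) (f : I -> ('I_n -> R) -> R) :
  (forall i, cube_bounded (f i)) ->
  cube_bounded (fun x => \sum_(i <- s) c i * f i x) /\
  E (fun x => \sum_(i <- s) c i * f i x) = \sum_(i <- s) c i * E (f i).
Proof.
move=> bf; elim: s => [|i s [bs Es]].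
  rewrite big_nil (_ : (fun x => _) = fun=> 0); last first.
    by apply/funext => x; rewrite big_nil.
  by split; [exact: cube_bounded_cst|exact: E_cst].
rewrite (_ : (fun x => _) = fun x => c i * f i x + \sum_(j <- s) c j * f j x).
  by rewrite big_cons E_linear // Es; split => //; exact: cube_bounded_lin.
by apply/funext => x; rewrite big_cons.
Qed.

Let wordI (w : seq bool) (x : 'I_n -> R) : R := (word x (size w) == w)%:R.

Let bounded_wordI w : cube_bounded (wordI w).
Proof. by exists 1 => x _; rewrite /wordI; case: eqP => _; rewrite ?normr1 ?normr0. Qed.

Let p (w : seq bool) : R := E (wordI w).

Let p_ge0 w : 0 <= p w.
Proof. by apply: E_ge0 => // x _; exact: ler0n. Qed.

Let p_nil : p [::] = 1.
Proof. by rewrite -E1; congr E; apply/funext. Qed.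

Let p_split w : p w = p (false :: w) + p (true :: w).
Proof.
rewrite /p -[E (wordI (false :: w))]mul1r -E_linear //; congr E; apply/funext => x.
rewrite /wordI /= !eqseq_cons mul1r; case: (word x (size w) == w); rewrite ?andbF ?andbT.
  by case: (_ <= _) => /=; rewrite ?addr0 ?add0r.
by rewrite addr0.
Qed.

Let E_word (phi : seq bool -> R) m :
  cube_bounded (fun x => phi (word x m)) /\
  E (fun x => phi (word x m)) = \sum_(w : m.-tuple bool) phi w * p w.
Proof.
have [b e] := E_sum (index_enum {: m.-tuple bool}) (fun w => phi w)
  (fun w : m.-tuple bool => bounded_wordI w).
rewrite -e; suff -> : (fun x => phi (word x m)) =
    (fun x => \sum_(w : m.-tuple bool) phi w * wordI w x) by split.
apply/funext => x; pose w := Tuple (introT eqP (size_word x m)).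
rewrite (bigD1 w) //= big1 ?addr0 => [|v vw].
  by rewrite /wordI /= size_word eqxx mulr1.
rewrite /wordI size_tuple; case: eqP => [e'|_]; last by rewrite mulr0.
by case/eqP: vw; apply: val_inj.
Qed.

(** The weights that E gives to the dyadic cells cut the unit interval into nested
    subintervals of the same lengths. Let h t be the common point of the cells
    whose intervals contain t. A function that depends on the first m digits only
    has the same expectation under E and under Lebesgue measure, and monomials
    are uniform limits of such functions. Countable additivity is thus borrowed
    from Lebesgue measure, although E is only finitely additive. *)
Theorem cube_representation : exists h : measurableTypeR R -> 'I_n -> R,
  [/\ forall i, measurable_fun setT (h ^~ i),
      forall t, unit_cube (h t) &
      forall a : 'I_n -> nat,
        \int[unit_measure R]_t (\prod_i h t i ^+ a i) =
        E (fun x => \prod_i x i ^+ a i)].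
Proof.
pose b (t : measurableTypeR R) := path_of p t.
pose v m (t : measurableTypeR R) (i : 'I_n) := value R (b t m) i.
pose h (t : measurableTypeR R) (i : 'I_n) := digit_limit R (b t) i.
have vh m t i : v m t i <= h t i <= v m t i + (2 ^+ depth m i)^-1.
  apply: digit_limitP => [k|k]; first exact: size_path_of.
  by rewrite /b /=; eexists.
have val01 w : unit_cube (@value R n' w).
  have vv : forall i : 'I_n, 0 <= value R w i /\
      value R w i + ((2 : R) ^+ depth (size w) i)^-1 <= 1.
    elim: w => [|c w IHw] i; first by rewrite /= add0r expr0 invr1.
    case: (IHw i) => IH1 IH2; have [u1 u2] := value_cons R c w i.
    by split; [exact: le_trans IH1 u1|exact: le_trans u2 IH2].
  move=> i; have [-> /=] := vv i; apply: le_trans.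
  by rewrite lerDl invr_ge0 exprn_ge0.
have v01 m t : unit_cube (v m t) by exact: val01.
have h01 t : unit_cube (h t).
  move=> i; have := vh 0 t i; rewrite /v /b /=.
  by rewrite add0r expr0 invr1.
have mv m i : measurable_fun setT (v m ^~ i).
  exact: (measurable_comp_path_of p (fun w => value R w i) m).
have depth_small (i : 'I_n) k : (2 ^+ depth (n * k) i)^-1 <= (2 ^+ k)^-1 :> R.
  rewrite lef_pV2 ?posrE ?exprn_gt0 // ler_eXn2l ?ltr1n //.
  exact: depth_block.
have mh i : measurable_fun setT (h ^~ i).
  apply: (@measurable_fun_cvg _ _ _ setT (fun k => v (n * k)%N ^~ i)) => //.
  move=> t _; apply/cvgrPdist_le => e e0.
  have c0 : `|(2 : R)^-1| < 1 by rewrite ger0_norm ?invf_lt1 ?ltr1n.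
  have /cvgrPdist_le/(_ _ e0) := cvg_expr c0; apply: filterS => k.
  rewrite sub0r normrN exprVn ger0_norm ?invr_ge0 ?exprn_ge0 // => ke.
  have /andP[l u] := vh (n * k)%N t i.
  rewrite ger0_norm ?subr_ge0 // lerBlDl; apply: le_trans u _; rewrite lerD2l.
  exact: le_trans (depth_small i k) ke.
exists h; split => // a.
pose F (x : 'I_n -> R) := \prod_i x i ^+ a i.
have X01 (x : R) k : 0 <= x <= 1 -> 0 <= x ^+ k <= 1.
  by move=> /andP[x0 x1]; rewrite exprn_ge0 // exprn_ile1.
have F1 x : unit_cube x -> `|F x| <= 1.
  move=> x01; rewrite ger0_norm.
    by apply: prodr_ile1 => i _; exact: X01.
  by apply: prodr_ge0 => i _; case/andP: (X01 _ (a i) (x01 i)).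
have Flip x y e : unit_cube x -> unit_cube y ->
    (forall i, `|x i - y i| <= e) -> `|F x - F y| <= (\sum_i (a i)%:R) * e.
  move=> x01 y01 xy; apply: le_trans (dist_prod_le _ _ _) _.
  - by move=> i; exact: X01.
  - by move=> i; exact: X01.
  rewrite mulr_suml; apply: ler_sum => i _.
  apply: le_trans (dist_expr_le _ _ _) _ => //.
  by rewrite ler_wpM2l // xy.
have mF (g : measurableTypeR R -> 'I_n -> R) :
    (forall i, measurable_fun setT (g ^~ i)) -> measurable_fun setT (F \o g).
  move=> mg; apply: measurable_prod => i _.
  by apply: measurable_funX.
have P1 := unit_measureT R.
apply/eqP; rewrite -subr_eq0 -normr_le0.
apply: (@le_div_exp2_le0 _ _ (2 * \sum_i (a i)%:R)) => k.
set m := (n * k)%N.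
pose A := \int[unit_measure R]_t F (v m t).
have AE : A = E (fun x => F (value R (word x m))).
  have [_ ->] := E_word (fun w => F (value R w)) m.
  by rewrite /A /Rintegral
    (integral_path_of p_ge0 p_nil p_split (fun w => F (value R w))).
rewrite -/(F _); have -> : \int[unit_measure R]_t F (h t) - E F =
   (\int[unit_measure R]_t F (h t) - A) + (A - E F) by ring.
apply: le_trans (ler_normD _ _) _.
rewrite -mulrA mulr2n mulrDl mul1r; apply: lerD.
  apply: (@dist_Rintegral_le _ _ _ _ _ _ 1) => //.
  - exact: mF.
  - exact: mF.
  - by move=> t; exact: F1.
  - by move=> t; exact: F1.
  move=> t; apply: Flip => // i; have /andP[l u] := vh m t i.
  rewrite ger0_norm ?subr_ge0 // lerBlDl; apply: le_trans u _.
  by rewrite lerD2l depth_small.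
rewrite AE; have [bw _] := E_word (fun w => F (value R w)) m.
apply: E_dist => //; first by exists 1.
move=> x x01; rewrite distrC; apply: Flip => // i.
by apply: le_trans (dist_value_word _ _ x01) _; exact: depth_small.
Qed.

End CubeRepresentation.

(** * The Hausdorff moment problem *)

Section Hausdorff.
Variables (R : realType) (n' : nat).
Let n := n'.+1.
Variables (A : comAlgType R) (L : {scalar A}) (u : 'I_n -> A).
Hypothesis L1 : L 1 = 1.
Hypothesis L_ge0 : forall N (v : 'I_n -> 'I_N.+1),
  0 <= L (\prod_i (u i ^+ v i * (1 - u i) ^+ (N - v i))).

Let W N (v : {ffun 'I_n -> 'I_N.+1}) : R := L (\prod_i bernstein N (v i) (u i)).

Let W_ge0 N v : 0 <= @W N v.
Proof.
rewrite /W /bernstein -(eq_bigr _ (fun i _ => mulr_natl _ _)) big_split /=.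
by rewrite -natr_prod mulr_natl linearMn /= mulrn_wge0.
Qed.

Let monomial_sum N (a : 'I_n -> nat) : (forall i, a i <= N)%N ->
  L (\prod_i u i ^+ a i) =
  \sum_(v : {ffun 'I_n -> 'I_N.+1})
    W v * \prod_i ((v i ^_ a i)%:R / (N ^_ a i)%:R).
Proof.
move=> aN.
have E i : u i ^+ a i = \sum_(v < N.+1)
    ((v ^_ a i)%:R / (N ^_ a i)%:R : R) *: bernstein N v (u i).
  have f0 : (N ^_ a i)%:R != 0 :> R by rewrite pnatr_eq0 -lt0n ffact_gt0.
  have := bernstein_ffact (u i) (aN i).
  move/(congr1 (fun x => ((N ^_ a i)%:R^-1 : R) *: x)).
  rewrite /= -[u i ^+ _ *+ _](scaler_nat (R := R)) scalerA mulVf // scale1r => <-.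
  rewrite scaler_sumr; apply: eq_bigr => v _.
  by rewrite -[bernstein _ _ _ *+ _](scaler_nat (R := R)) scalerA mulrC.
rewrite (eq_bigr _ (fun i _ => E i)) bigA_distr_bigA linear_sum /=.
by apply: eq_bigr => v _; rewrite scaler_prod linearZ /= mulrC.
Qed.

Let sum_W N : \sum_(v : {ffun 'I_n -> 'I_N.+1}) W v = 1.
Proof.
have := @monomial_sum N (fun=> 0%N) (fun=> leq0n N).
rewrite (eq_bigr (fun=> 1)) => [|i _]; last by rewrite expr0.
rewrite big1_eq L1 => ->; apply: eq_bigr => v _.
by rewrite big1 ?mulr1 // => i _; rewrite !ffactn0 divr1.
Qed.

Let grid N (v : {ffun 'I_n -> 'I_N.+1}) (i : 'I_n) : R := (v i)%:R / N%:R.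

Let grid01 N v : unit_cube (@grid N v).
Proof.
move=> i; rewrite /grid divr_ge0 //=; case: N v => [|N] v.
  by rewrite invr0 mulr0 ler01.
by rewrite ler_pdivrMr ?ltr0n // mul1r ler_nat -ltnS.
Qed.

Let S N (phi : ('I_n -> R) -> R) : R :=
  \sum_(v : {ffun 'I_n -> 'I_N.+1}) W v * phi (grid v).

Let S_bound N phi M : (forall x, unit_cube x -> `|phi x| <= M) -> `|S N phi| <= M.
Proof.
move=> bM; apply: le_trans (ler_norm_sum _ _ _) _.
rewrite -[M]mul1r -(sum_W N) mulr_suml; apply: ler_sum => v _.
by rewrite normrM ger0_norm // ler_wpM2l // bM.
Qed.

Let S_monomial (a : 'I_n -> nat) :
  S N (fun x => \prod_i x i ^+ a i) @[N --> \oo] --> L (\prod_i u i ^+ a i).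
Proof.
apply/cvgrPdist_le => e e0.
pose B := (\sum_i a i)%N.
have aB i : (a i <= B)%N by rewrite /B (bigD1 i) //= leq_addr.
pose C : R := \sum_(i < n) (B ^ 2)%:R.
have C0 : 0 <= C by apply: sumr_ge0.
near=> N.
have BN : (B < N)%N by near: N; exact: nbhs_infty_gt.
have NB : C / e < (N - B)%:R.
  apply: lt_le_trans (archi_boundP (divr_ge0 C0 (ltW e0))) _.
  rewrite ler_nat -(leq_add2r B) subnK ?(ltnW BN) //.
  by near: N; exact: nbhs_infty_ge.
have NB0 : 0 < (N - B)%:R :> R by rewrite ltr0n subn_gt0.
have aN i : (a i < N)%N by apply: leq_ltn_trans (aB i) BN.
rewrite (@monomial_sum N) => [|i]; last exact: ltnW.
rewrite /S -sumrB; apply: le_trans (ler_norm_sum _ _ _) _.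
have -> : e = \sum_(v : {ffun 'I_n -> 'I_N.+1}) W v * e.
  by rewrite -mulr_suml sum_W mul1r.
apply: ler_sum => v _; rewrite -mulrBr normrM ger0_norm // ler_wpM2l //.
apply: le_trans (dist_prod_le _ _ _) _.
- by move=> i; apply: ffact_ratio_bounds; exact: ltnW.
- move=> i; have /andP[g0 g1] := grid01 v i.
  by rewrite exprn_ge0 // exprn_ile1.
apply: (@le_trans _ _ (C / (N - B)%:R)); last first.
  by rewrite ler_pdivrMr // mulrC -ler_pdivrMr // ltW.
rewrite mulr_suml; apply: ler_sum => i _.
apply: le_trans (ffact_ratio_approx _ _ (aN i)) _.
apply: ler_pM => //; rewrite ?invr_ge0 //.
  by rewrite ler_nat leq_exp2r.
by rewrite lef_pV2 ?posrE ?ltr0n ?subn_gt0 // ler_nat leq_sub2l.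
Unshelve. all: by end_near. Qed.

(** The coefficients of the Bernstein expansion are nonnegative weights on the
    grid of mesh 1 / N, and the expectations of monomials under these weights
    tend to the values of L. A limit of the weights along an ultrafilter is a
    positive functional on all bounded functions of the cube. *)
Theorem hausdorff_moment : exists h : measurableTypeR R -> 'I_n -> R,
  [/\ forall i, measurable_fun setT (h ^~ i),
      forall t, unit_cube (h t) &
      forall a : 'I_n -> nat,
        \int[unit_measure R]_t (\prod_i h t i ^+ a i) = L (\prod_i u i ^+ a i)].
Proof.
have [U [UU infU]] := ultraFilterLemma eventually_filter.
pose E (phi : ('I_n -> R) -> R) : R := lim (S N phi @[N --> U]).
have Ecvg phi : cube_bounded phi -> S N phi @[N --> U] --> E phi.
  move=> [M bM].
  have [|l Sl] := @ultra_bounded_cvg R _ U (fun N => S N phi) M UU.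
    by apply: nearW => N; exact: S_bound.
  by rewrite /E (cvg_lim _ Sl).
have E_linear c phi psi : cube_bounded phi -> cube_bounded psi ->
    E (fun x => c * phi x + psi x) = c * E phi + E psi.
  move=> bp bq; apply: cvg_lim => //.
  have -> : (fun N => S N (fun x => c * phi x + psi x)) =
      (fun N => c * S N phi + S N psi).
    apply/funext => N; rewrite /S mulr_sumr -big_split /=.
    by apply: eq_bigr => v _; rewrite mulrDr mulrCA.
  by apply: cvgD; [apply: cvgM; [exact: cvg_cst|exact: Ecvg]|exact: Ecvg].
have E_ge0 phi : cube_bounded phi ->
    (forall x, unit_cube x -> 0 <= phi x) -> 0 <= E phi.
  move=> bp p0; apply: limr_ge; first by apply/cvg_ex; exists (E phi); exact: Ecvg.
  by apply: nearW => N; apply: sumr_ge0 => v _; apply: mulr_ge0 => //; exact: p0.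
have E1 : E (fun=> 1) = 1.
  apply: cvg_lim => //.
  have -> : (fun N => S N (fun=> 1)) = fun=> 1.
    by apply/funext => N; rewrite /S -mulr_suml sum_W mulr1.
  exact: cvg_cst.
have [h [mh h01 hE]] := cube_representation E_linear E_ge0 E1.
exists h; split => // a; rewrite hE; apply: cvg_lim => //.
by apply: cvg_trans (@S_monomial a); exact: cvg_app.
Qed.

End Hausdorff.

(** * Moment functionals of exponential growth *)

Lemma bernoulli_ineq (R : realDomainType) (d : R) k :
  -1 <= d -> 1 + k%:R * d <= (1 + d) ^+ k.
Proof.
move=> d1; elim: k => [|k IHk]; first by rewrite mul0r addr0 expr0.
have d0 : 0 <= 1 + d by rewrite -lerBlDl sub0r.
rewrite exprS; apply: le_trans (ler_wpM2l d0 IHk).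
have := mulr_ge0 (ler0n R k) (sqr_ge0 d); rewrite -natr1 expr2 => h; lra.
Qed.

(** The Cauchy-Schwarz inequality in the form used below: a nonnegative quadratic
    form has a nonnegative discriminant. *)
Lemma quadratic_form_ge0 (R : realFieldType) (a b c : R) :
  (forall x y, 0 <= x ^+ 2 * a + 2 * x * y * b + y ^+ 2 * c) -> b ^+ 2 <= a * c.
Proof.
move=> Q; have a0 : 0 <= a by have := Q 1 0; lra.
have c0 : 0 <= c by have := Q 0 1; lra.
have [c_gt0|c_le0] := ltP 0 c.
  have := Q c (- b); have -> : c ^+ 2 * a + 2 * c * - b * b + (- b) ^+ 2 * c =
    c * (a * c - b ^+ 2) by ring.
  by rewrite pmulr_rge0 // subr_ge0.
have c_eq0 : c = 0 by apply/eqP; rewrite eq_le c_le0 c0.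
have := Q b (- (a + 1)); rewrite c_eq0 !mulr0 addr0.
have -> : b ^+ 2 * a + 2 * b * - (a + 1) * b = - (b ^+ 2 * (a + 2)) by ring.
by rewrite oppr_ge0 pmulr_lle0 // ltr_wpDl.
Qed.

(** The ratio of consecutive terms of a log-convex sequence is nondecreasing, so
    an exponential growth rate of the sequence bounds already its first
    ratio. *)
Lemma log_convex_growth (R : realType) (s : nat -> R) (rho C : R) :
  (forall k, 0 <= s k) -> (forall k, s k.+1 ^+ 2 <= s k * s k.+2) ->
  0 < rho -> (forall k, s k <= C * rho ^+ k) -> s 1 <= rho * s 0.
Proof.
move=> s0 sS rho0 sC; rewrite leNgt; apply/negP => s10.
have s0_gt0 : 0 < s 0.
  rewrite lt_neqAle s0 andbT; apply/eqP => e.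
  have := sS 0; rewrite -e mul0r; move: s10; rewrite -e mulr0 => s1.
  by rewrite leNgt exprn_gt0.
pose sg := s 1 / s 0.
have sg_rho : rho < sg by rewrite /sg ltr_pdivlMr.
have sg0 : 0 < sg by apply: lt_trans sg_rho.
have step k : 0 < s k /\ sg * s k <= s k.+1.
  elim: k => [|k [sk skS]]; first by rewrite /sg divfK // gt_eqF.
  have skS0 : 0 < s k.+1 by apply: lt_le_trans skS; exact: mulr_gt0.
  split=> //; rewrite -(ler_pM2l sk); apply: le_trans (sS k).
  by rewrite expr2 mulrA [s k * sg]mulrC ler_pM2r.
have low k : s 0 * sg ^+ k <= s k.
  elim: k => [|k IHk]; first by rewrite expr0 mulr1.
  have [_ st] := step k; apply: le_trans st.
  by rewrite exprS mulrCA ler_pM2l.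
pose d := sg / rho - 1.
have d0 : 0 < d by rewrite /d subr_gt0 ltr_pdivlMr // mul1r.
have ratio k : s 0 * (1 + k%:R * d) <= C.
  have rk : 0 < rho ^+ k by rewrite exprn_gt0.
  rewrite -(ler_pM2r rk); apply: le_trans (sC k).
  apply: le_trans (low k); rewrite -mulrA ler_pM2l //.
  have -> : sg ^+ k = (1 + d) ^+ k * rho ^+ k.
    by rewrite -exprMn /d addrC subrK divfK // gt_eqF.
  rewrite ler_pM2r //; apply: bernoulli_ineq.
  by apply: le_trans (ltW d0); rewrite lerN10.
have sd : 0 < s 0 * d by exact: mulr_gt0.
have C0 : 0 <= C.
  by have := ratio 0; rewrite mul0r addr0 mulr1; apply: le_trans; exact: ltW.
have := archi_boundP (divr_ge0 C0 (ltW sd)); set k := Num.bound _.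
rewrite ltr_pdivrMr // => Ck; have := ratio k.
rewrite leNgt => /negP; apply; apply: lt_le_trans Ck _.
have -> : s 0 * (1 + k%:R * d) = s 0 + k%:R * (s 0 * d) by ring.
by rewrite lerDr ltW.
Qed.

Lemma measurable_meval d (T : measurableType d) (R : realType) n
    (h : T -> 'I_n -> R) (f : mpoly n R) :
  (forall i, measurable_fun setT (h ^~ i)) ->
  measurable_fun setT (fun t => meval (h t) f).
Proof.
move=> mh; under [X in measurable_fun _ X]eq_fun do rewrite mevalE.
apply: measurable_sum => a; apply: measurable_funM => //.
by apply: measurable_prod => i _; exact: measurable_funX.
Qed.

Lemma meval_bounded (R : realType) n (r : R) (f : mpoly n R) :
  exists M, forall x : 'I_n -> R, (forall i, `|x i| <= r) -> `|meval x f| <= M.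
Proof.
exists (\sum_(a <- msupp f) `|mcoeff a f| * \prod_(i < n) r ^+ a i) => x xr.
rewrite mevalE; apply: le_trans (ler_norm_sum _ _ _) _; apply: ler_sum => a _.
rewrite normrM ler_wpM2l // normr_prod; apply: ler_prod => i _.
rewrite normr_ge0 normrX lerXn2r // nnegrE //.
by apply: le_trans (xr i).
Qed.

Section PolynomialIntegral.
Context d (T : measurableType d) (R : realType) (n : nat).
Variables (mu : {measure set T -> \bar R}) (h : T -> 'I_n -> R) (r : R).
Hypothesis mu1 : mu setT = 1%E.
Hypothesis mh : forall i, measurable_fun setT (h ^~ i).
Hypothesis h_le : forall t i, `|h t i| <= r.

Lemma integrable_meval (f : mpoly n R) :
  mu.-integrable setT (EFin \o (fun t => meval (h t) f)).
Proof.
have [M fM] := meval_bounded r f.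
apply: (@bounded_integrable _ _ _ _ _ M) => //.
- by rewrite mu1 ltry.
- exact: measurable_meval.
- by move=> t; apply: fM => i.
Qed.

Lemma Rintegral_meval_lin (c : R) (f g : mpoly n R) :
  \int[mu]_t meval (h t) (c *: f + g) =
  c * \int[mu]_t meval (h t) f + \int[mu]_t meval (h t) g.
Proof.
rewrite -RintegralZl //; last exact: integrable_meval.
rewrite -RintegralD //; [|  |exact: integrable_meval].
  by apply: eq_Rintegral => t _; rewrite mevalD mevalZ.
by have := integrable_meval (c *: f); under eq_fun do rewrite /= mevalZ.
Qed.

End PolynomialIntegral.

Section ExponentialGrowth.
Variables (R : realType) (n' : nat).
Let n := n'.+1.
Variables (L : {scalar mpoly n R}) (r : R).
Hypothesis r_gt0 : 0 < r.
Hypothesis L_sqr : forall q, 0 <= L (q ^+ 2).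
Hypothesis L_growth : forall a, `|L (mpolyX R a)| <= r ^+ mdeg a.

Let X i : mpoly n R := mpolyX R (mnm1 i).
Let LC c f : c * L f = L (mpolyC n c * f).
Proof. by rewrite mul_mpolyC linearZ. Qed.

Let positive p := forall q, 0 <= L (p * q ^+ 2).

Let growth i f : exists C, forall k, L (X i ^+ k * f) <= C * r ^+ k.
Proof.
exists (\sum_(a <- msupp f) `|mcoeff a f| * r ^+ mdeg a) => k.
rewrite [f in L (_ * f)]mpolyE mulr_sumr linear_sum mulr_suml /=.
apply: ler_sum => a _; rewrite -scalerAr linearZ /=.
apply: le_trans (ler_norm _) _; rewrite normrM -mulrA ler_wpM2l //.
rewrite /X mpolyXn -mpolyXD; apply: le_trans (L_growth _) _.
by rewrite mdegD mdegMn mdeg1 mul1n exprD mulrC.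
Qed.

(** Positivity on squares and growth at most r give positivity of the functional
    localized at r^2 - X_i^2: the sequence s k = L (p X_i^2k q^2) is log-convex by
    the Cauchy-Schwarz inequality and grows at most like r^2k, whence
    s 1 <= r^2 s 0. *)
Let positive_ball i p : positive p -> positive (p * (mpolyC n (r ^+ 2) - X i ^+ 2)).
Proof.
move=> pp q; pose s k := L (p * (X i ^+ k * q) ^+ 2).
have sE k : s k = L (X i ^+ (k * 2) * (p * q ^+ 2)).
  by rewrite /s exprMn -exprM mulrCA.
have [C sC] := growth i (p * q ^+ 2).
have : s 1%N <= r ^+ 2 * s 0%N.
  apply: (@log_convex_growth _ _ _ C) => [k|k||k].
  - exact: pp.
  - apply: quadratic_form_ge0 => x y.
    suff -> : x ^+ 2 * s k + 2 * x * y * s k.+1 + y ^+ 2 * s k.+2 =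
        L (p * (mpolyC n x * (X i ^+ k * q) + mpolyC n y * (X i ^+ k.+2 * q)) ^+ 2).
      exact: pp.
    rewrite /s !LC -!(linearD L); congr (L _).
    by rewrite !exprS; ring.
  - exact: exprn_gt0.
  - by rewrite sE -exprM mulnC.
rewrite -subr_ge0 /s expr0 mul1r expr1 LC -(linearB L).
by rewrite (_ : _ - _ = p * (mpolyC n (r ^+ 2) - X i ^+ 2) * q ^+ 2) //; ring.
Qed.

Let c : mpoly n R := mpolyC n (2 * r)^-1.
(* The affine change of variables that maps [-r, r] to [0, 1]. *)
Let u i : mpoly n R := c * (mpolyC n r + X i).

Let c2r : c * (mpolyC n r *+ 2) = 1.
Proof.
rewrite /c -mpolyCMn -mpolyCM -(mpolyC1 n R); congr mpolyC.
by field; rewrite gt_eqF.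
Qed.

Let u_compl i : 1 - u i = c * (mpolyC n r - X i).
Proof. by rewrite -c2r /u; ring. Qed.

(** With e = 1 or e = -1 this is positivity at the two bounding hyperplanes
    X_i = - r and X_i = r, and follows from the identity
    2 r (r + e X_i) = (r + e X_i)^2 + (r^2 - X_i^2). *)
Let positive_linear i p e : e ^+ 2 = 1 -> positive p ->
  positive (p * (c * (mpolyC n r + e * X i))).
Proof.
move=> e2 pp q.
have E : p * (c * (mpolyC n r + e * X i)) * q ^+ 2 =
    (c ^+ 2) * (p * ((mpolyC n r + e * X i) * q) ^+ 2 +
      p * (mpolyC n (r ^+ 2) - X i ^+ 2) * q ^+ 2).
  rewrite rmorphXn /= -[in LHS](mulr1 c) -[X in c * X * _]c2r.
  rewrite (_ : X i ^+ 2 = e ^+ 2 * X i ^+ 2); last by rewrite e2 mul1r.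
  ring.
rewrite E /c -rmorphXn -LC; apply: mulr_ge0; first exact: sqr_ge0.
by rewrite (linearD L); apply: addr_ge0; [exact: pp|exact: positive_ball].
Qed.

Let positive_prod N (v : 'I_n -> 'I_N.+1) :
  positive (\prod_i (u i ^+ v i * (1 - u i) ^+ (N - v i))).
Proof.
have pow p e i k : e ^+ 2 = 1 -> positive p ->
    positive (p * (c * (mpolyC n r + e * X i)) ^+ k).
  move=> e2 pp; elim: k => [|k IHk]; first by rewrite expr0 mulr1.
  by rewrite exprSr [p * _]mulrA; exact: positive_linear.
elim: (index_enum _) => [|i s IHs].
  by rewrite big_nil => q; rewrite mul1r.
rewrite big_cons mulrC mulrA.
have -> : 1 - u i = c * (mpolyC n r + (-1) * X i) by rewrite u_compl mulN1r.
have -> : u i = c * (mpolyC n r + 1 * X i) by rewrite /u mul1r.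
by apply/pow; rewrite ?sqrrN ?expr1n //; apply/pow; rewrite ?expr1n.
Qed.

(** The functional is nonnegative on all products of the polynomials r + X_i and
    r - X_i, which are the Bernstein polynomials of the cube [-r, r]^n up to
    positive factors. *)
Theorem exponential_growth_moment : L 1 = 1 ->
  exists h : measurableTypeR R -> 'I_n -> R,
  [/\ forall i, measurable_fun setT (h ^~ i),
      forall t i, `|h t i| <= r &
      forall f, \int[unit_measure R]_t meval (h t) f = L f].
Proof.
move=> L1.
have Lu_ge0 N (v : 'I_n -> 'I_N.+1) :
    0 <= L (\prod_i (u i ^+ v i * (1 - u i) ^+ (N - v i))).
  by have := @positive_prod N v 1; rewrite expr1n mulr1.
have [h [mh h01 hE]] := hausdorff_moment L1 Lu_ge0.
pose U := [tuple u i | i < n].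
pose V := [tuple mpolyC n (2 * r) * X i - mpolyC n r | i < n].
exists (fun t i => 2 * r * h t i - r); split.
- by move=> i; apply: measurable_funB => //; exact: measurable_funM.
- move=> t i; have /andP[h0 h1] := h01 t i.
  have := mulr_ge0 (ltW r_gt0) h0.
  have : 0 <= r * (1 - h t i) by rewrite mulr_ge0 ?subr_ge0 // ltW.
  by rewrite ler_norml => ? ?; apply/andP; split; lra.
move=> f.
have LU (g : mpoly n R) :
    \int[unit_measure R]_t meval (h t) g = L (comp_mpoly U g).
  have h1 t i : `|h t i| <= 1.
    by have /andP[h0 h1] := h01 t i; rewrite ger0_norm.
  have P1 := unit_measureT R.
  elim/mpolyind: g => [|c0 m p _ _ IHp].
    have := Rintegral_meval_lin P1 mh h1 (-1) 0 0.
    by rewrite scaler0 addr0 mulN1r addNr comp_mpoly0 raddf0.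
  rewrite (Rintegral_meval_lin P1 mh h1) IHp comp_mpolyD comp_mpolyZ.
  rewrite linearD linearZ /= comp_mpolyX; congr (_ * _ + _).
  under eq_bigr do rewrite tnth_mktuple.
  by rewrite -hE; apply: eq_Rintegral => t _; rewrite mevalX.
have fVU : comp_mpoly U (comp_mpoly V f) = f.
  have VU i : comp_mpoly U (tnth V i) = X i.
    rewrite tnth_mktuple comp_mpolyB mul_mpolyC comp_mpolyZ comp_mpolyC.
    rewrite comp_mpolyXU -tnth_nth tnth_mktuple /u -mul_mpolyC.
    have -> : mpolyC n (2 * r) = mpolyC n r *+ 2 by rewrite mulr_natl mpolyCMn.
    by rewrite mulrA [_ *+ 2 * c]mulrC c2r mul1r addrC addKr.
  elim/mpolyind: f => [|c0 m p _ _ IHp]; first by rewrite !comp_mpoly0.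
  rewrite !comp_mpolyD !comp_mpolyZ IHp comp_mpolyX rmorph_prod mpolyXE_id.
  congr (_ *: _ + _); apply: eq_bigr => i _; rewrite rmorphXn; congr (_ ^+ _).
  exact: VU.
rewrite -[in RHS]fVU -LU; apply: eq_Rintegral => t _.
rewrite comp_mpoly_meval; apply: meval_eq => i.
by rewrite tnth_mktuple mevalB mevalM !mevalC mevalXU.
Qed.

End ExponentialGrowth.

(** * Borel sets and random vectors of R^n *)

Section BorelRow.
Variables (R : realType) (n : nat).

(** These sets are closed under finite intersections, contain the boxes, and have
    indicator functions that are limits of polynomials; they serve as generators
    of the Borel sets. *)
Definition negativity_set (s : seq (mpoly n R)) : set (borel_rV R n) :=
  [set x | forall p, p \in s -> peval p x < 0].

(** The box of radius 1 / (z.2 + 1) around the rational point z.1, given by 2 n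
    affine inequalities. *)
Definition open_box (z : 'rV[rat]_n * nat) : seq (mpoly n R) :=
  [seq mpolyX R (mnm1 i) - mpolyC n (ratr (z.1 ord0 i) + z.2.+1%:R^-1) | i : 'I_n] ++
  [seq mpolyC n (ratr (z.1 ord0 i) - z.2.+1%:R^-1) - mpolyX R (mnm1 i) | i : 'I_n].

Lemma open_boxE z (x : 'rV[R]_n) :
  negativity_set (open_box z) x <->
  forall i, `|x ord0 i - ratr (z.1 ord0 i)| < z.2.+1%:R^-1.
Proof.
have pe i c : peval (mpolyX R (mnm1 i) - mpolyC n c) x = x ord0 i - c.
  by rewrite /peval mevalB mevalXU mevalC.
have pe' i c : peval (mpolyC n c - mpolyX R (mnm1 i)) x = c - x ord0 i.
  by rewrite /peval mevalB mevalXU mevalC.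
split=> [xz i|xz p].
  have h1 : x ord0 i - (ratr (z.1 ord0 i) + z.2.+1%:R^-1) < 0.
    rewrite -pe; apply: xz; rewrite mem_cat; apply/orP; left.
    by apply/mapP; exists i; rewrite ?mem_enum.
  have h2 : ratr (z.1 ord0 i) - z.2.+1%:R^-1 - x ord0 i < 0.
    rewrite -pe'; apply: xz; rewrite mem_cat; apply/orP; right.
    by apply/mapP; exists i; rewrite ?mem_enum.
  rewrite ltr_norml; move: h1 h2; move: (_.+1%:R^-1) => e h1 h2.
  by apply/andP; split; lra.
rewrite mem_cat => /orP[] /mapP[i _ ->]; rewrite ?pe ?pe';
  by have := xz i; move: (_.+1%:R^-1) => e; rewrite ltr_norml => /andP[? ?]; lra.
Qed.

Lemma open_bigcup_box (U : set 'rV[R]_n) : open U ->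
  U = \bigcup_(z in [set z | negativity_set (open_box z) `<=` U])
        negativity_set (open_box z).
Proof.
move=> oU; apply/seteqP; split => x; last by move=> [z zU]; exact: zU.
move=> Ux; have /nbhs_ballP[e /= e0 eU] := open_nbhs_nbhs (conj oU Ux).
pose k := Num.bound (2 / e).
have kP : 2 / e < k.+1%:R :> R.
  apply: lt_trans (archi_boundP _) _; first by rewrite divr_ge0 // ltW.
  by rewrite ltr_nat.
have k0 : 0 < k.+1%:R^-1 :> R by rewrite invr_gt0.
have ke : k.+1%:R^-1 + k.+1%:R^-1 < e.
  have -> : k.+1%:R^-1 + k.+1%:R^-1 = 2 / k.+1%:R :> R.
    by move: (_.+1%:R^-1) => c; lra.
  by rewrite ltr_pdivrMr // mulrC -ltr_pdivrMr.
have q_ex i : exists q : rat, `|x ord0 i - ratr q| < k.+1%:R^-1.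
  have [|q] := @rat_in_itvoo R (x ord0 i - k.+1%:R^-1) (x ord0 i + k.+1%:R^-1).
    by move: k0; move: (_.+1%:R^-1) => c c0; lra.
  rewrite in_itv /= ; move: (_.+1%:R^-1) => c /andP[? ?].
  by exists q; rewrite ltr_norml; apply/andP; split; lra.
have [q qP] := choice q_ex.
exists (\row_i q i, k) => [y /open_boxE yq|].
  apply: eU; split=> // i j; rewrite (ord1 i).
  have := yq j; have := qP j; rewrite /= mxE !ltr_norml.
  move: ke; move: (_.+1%:R^-1) => c ke /andP[? ?] /andP[? ?].
  by rewrite /ball /= ltr_norml; apply/andP; split; lra.
by apply/open_boxE => i; rewrite /= mxE; exact: qP.
Qed.

Lemma measurable_negativity_comp d (T : measurableType d) (h : T -> 'rV[R]_n) s :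
  (forall i, measurable_fun setT (fun t => h t ord0 i)) ->
  measurable (h @^-1` negativity_set s).
Proof.
move=> mh; elim: s => [|p s IHs].
  by rewrite (_ : _ @^-1` _ = setT) //; apply/seteqP; split.
rewrite (_ : _ @^-1` _ = (fun t => peval p (h t)) @^-1` `]-oo, 0[%classic `&`
    h @^-1` negativity_set s).
  apply: measurableI => //; rewrite -[X in measurable X]setTI.
  have := @measurable_meval _ T R n (fun t => h t ord0) p mh.
  by apply => //; exact: measurable_itv.
apply/seteqP; split => t /=.
  move=> ht; split; first by rewrite in_itv /=; apply: ht; rewrite mem_head.
  by move=> q qs; apply: ht; rewrite in_cons qs orbT.
by rewrite in_itv /= => -[pt st] q; rewrite in_cons => /orP[/eqP->//|]; exact: st.
Qed.

Lemma measurable_fun_rV d (T : measurableType d) (h : T -> borel_rV R n) :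
  (forall i, measurable_fun setT (fun t => (h t : 'rV[R]_n) ord0 i)) ->
  measurable_fun setT h.
Proof.
move=> mh; apply: (measurability (@open 'rV[R]_n : set (set (borel_rV R n)))) => //.
move=> _ [U oU <-]; rewrite setTI (open_bigcup_box oU) preimage_bigcup.
rewrite bigcup_mkcond; apply: countable_bigcupT_measurable => // z.
by case: ifP => // _; exact: measurable_negativity_comp.
Qed.

Lemma measurable_coord i : measurable_fun setT (fun x : borel_rV R n => x ord0 i).
Proof.
apply: (measurability _ (RGenOpens.measurableE R)).
move=> _ [_ [a [b ->]] <-]; rewrite setTI; apply: sub_sigma_algebra.
apply: open_comp; last exact: itv_open.
by move=> x _; exact: coord_continuous.
Qed.

Lemma measurable_peval p : measurable_fun setT (peval p : borel_rV R n -> R).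
Proof. by apply: measurable_meval => i; exact: measurable_coord. Qed.

Lemma measurable_negativity_set s : measurable (negativity_set s).
Proof.
have := @measurable_negativity_comp _ (borel_rV R n) id s.
by apply => i; exact: measurable_coord.
Qed.

Lemma sigma_negativity_set (A : set (borel_rV R n)) : measurable A ->
  <<s [set negativity_set s | s in setT] >> A.
Proof.
move=> mA; apply: mA; split; first exact: smallest_sigma_algebra.
move=> U oU; rewrite (open_bigcup_box oU).
set G := [set _ | _ in _].
have mG (z : 'rV[rat]_n * nat) :
    (@measurable _ (g_sigma_algebraType G)) (negativity_set (open_box z)).
  by apply: sub_sigma_algebra; exists (open_box z).
rewrite bigcup_mkcond.
apply: (@countable_bigcupT_measurable _ (g_sigma_algebraType G)) => // z.
by case: ifP.
Qed.

End BorelRow.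

(** * Bounded random vectors are determined by their moments *)

Section StepFunction.
Variable R : realType.

(** For M = N 4^N the polynomials (1 - u^2N)^M map the unit interval to itself and
    tend pointwise to the indicator of u < 1/2. Indeed they lie between
    1 - M u^2N = 1 - N (2 u)^2N and 1 / (1 + N (2 u)^2N). The factor N in M is
    what forces the limit 0 at u = 1/2. *)
Definition step_exp (N : nat) : nat := (N * 2 ^ (2 * N))%N.

Lemma geometric_bound (z : R) N : 0 <= z <= 1 -> N%:R * z ^+ N * (1 - z) <= 1.
Proof.
move=> /andP[z0 z1].
suff : N%:R * z ^+ N * (1 - z) <= 1 - z ^+ N.
  by move/le_trans; apply; rewrite gerBl exprn_ge0.
elim: N => [|N IHN]; first by rewrite !mul0r expr0 subrr.
have zN0 : 0 <= z ^+ N.+1 by rewrite exprn_ge0.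
have zN1 : z ^+ N.+1 <= 1 by rewrite exprn_ile1.
have h1 : z * (N%:R * z ^+ N * (1 - z)) <= z * (1 - z ^+ N) by rewrite ler_wpM2l.
have h2 : 0 <= (1 - z) * (1 - z ^+ N.+1) by rewrite mulr_ge0 // subr_ge0.
rewrite -natr1; move: h1 h2; rewrite exprS; move: (z ^+ N) => w h1 h2.
lra.
Qed.

Lemma expr_1sub_le (x : R) m : 0 <= x <= 1 -> (1 - x) ^+ m * (1 + m%:R * x) <= 1.
Proof.
move=> /andP[x0 x1].
have h : 1 + m%:R * x <= (1 + x) ^+ m.
  by apply: bernoulli_ineq; apply: le_trans x0; rewrite lerN10.
have p0 : 0 <= (1 - x) ^+ m by rewrite exprn_ge0 // subr_ge0.
apply: le_trans (ler_wpM2l p0 h) _; rewrite -exprMn.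
rewrite (_ : _ * _ = 1 - x ^+ 2); last by ring.
by rewrite exprn_ile1 ?gerBl ?sqr_ge0 // subr_ge0 exprn_ile1.
Qed.

Lemma step_cvg (u : R) : 0 <= u <= 1 ->
  (1 - u ^+ (2 * N)) ^+ step_exp N @[N --> \oo] --> ((u < 1 / 2)%R%:R : R).
Proof.
move=> /andP[u0 u1].
have x01 N : 0 <= u ^+ (2 * N) <= 1 by rewrite exprn_ge0 // exprn_ile1.
have q0 N : 0 <= (1 - u ^+ (2 * N)) ^+ step_exp N.
  by rewrite exprn_ge0 // subr_ge0; case/andP: (x01 N).
have q1 N : (1 - u ^+ (2 * N)) ^+ step_exp N <= 1.
  by case/andP: (x01 N) => ? ?; rewrite exprn_ile1 ?gerBl // subr_ge0.
have mE N : (step_exp N)%:R * u ^+ (2 * N) = N%:R * (2 * u) ^+ N * (2 * u) ^+ N.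
  rewrite /step_exp natrM natrX -!mulrA; congr (_ * _).
  by rewrite -exprMn -exprD addnn mul2n.
case: ltP => u2.
  have z01 : 0 <= 2 * u <= 1 by apply/andP; split; lra.
  have zb N : N%:R * (2 * u) ^+ N <= (1 - 2 * u)^-1.
    have z1 : 0 < 1 - 2 * u by lra.
    rewrite -(ler_pM2r z1) mulVf ?gt_eqF //; exact: geometric_bound.
  have zc : (2 * u) ^+ N @[N --> \oo] --> 0.
    by apply: cvg_expr; rewrite ger0_norm; case/andP: z01 => // *; lra.
  apply: (@squeeze_cvgr _ _ _ _ (fun N => 1 - (1 - 2 * u)^-1 * (2 * u) ^+ N)
     (fun=> 1)).
  - apply: nearW => N; rewrite q1 andbT.
    have /andP[a0 a1] := x01 N.
    have : - 1 <= - u ^+ (2 * N) by rewrite lerN2.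
    move/bernoulli_ineq => /(_ (step_exp N)); apply: le_trans.
    rewrite mulrN mE lerD2l lerN2 ler_wpM2r //.
    by rewrite exprn_ge0 //; case/andP: z01.
  - have e : 1 - (1 - 2 * u)^-1 * 0 = true%:R by rewrite mulr0 subr0.
    rewrite -e; apply: cvgB; first exact: cvg_cst.
    by apply: cvgM => //; exact: cvg_cst.
  - exact: cvg_cst.
apply: (@squeeze_cvgr _ _ _ _ (fun=> 0) (@harmonic R)).
- apply: nearW => N; rewrite q0 /=.
  have h := expr_1sub_le (step_exp N) (x01 N).
  rewrite -[leRHS]mul1r ler_pdivlMr ?ltr0n //; apply: le_trans h.
  rewrite ler_wpM2l // -natr1 addrC lerD2l mE.
  have z1 : 1 <= (2 * u) ^+ N by apply: exprn_ege1; lra.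
  rewrite -[leLHS]mulr1; apply: ler_pM => //.
  by rewrite ler_peMr.
- exact: cvg_cst.
- exact: cvg_harmonic.
Qed.

End StepFunction.

Lemma law_exists d d' (T : measurableType d) (T' : measurableType d')
    (R : realType) (P : {measure set T -> \bar R}) (f : T -> T') :
  measurable_fun setT f ->
  exists2 mu : {measure set T' -> \bar R}, forall A, mu A = P (f @^-1` A) &
    forall phi : T' -> \bar R, measurable_fun setT phi ->
      P.-integrable setT (phi \o f) -> mu.-integrable setT phi /\
      (\int[mu]_z phi z = \int[P]_t phi (f t))%E.
Proof.
move=> mf; unshelve eexists.
- by refine (pushforward P f : {measure set T' -> \bar R}); exact: mf.
- by [].
move=> phi mphi Iphi; split; first exact: integrable_pushforward.
by rewrite integral_pushforward.
Qed.

Lemma cvg_prod (R : realType) (I : eqType) (s : seq I) (f : I -> nat -> R)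
    (l : I -> R) : (forall i, i \in s -> f i N @[N --> \oo] --> l i) ->
  \prod_(i <- s) f i N @[N --> \oo] --> \prod_(i <- s) l i.
Proof.
elim: s => [|i s IHs] fl.
  by rewrite big_nil; under eq_fun do rewrite big_nil; exact: cvg_cst.
rewrite big_cons; under eq_fun do rewrite big_cons.
apply: cvgM; first by apply: fl; rewrite mem_head.
by apply: IHs => j js; apply: fl; rewrite in_cons js orbT.
Qed.

Section Law.
Context d (T : measurableType d) (R : realType) (n : nat).
Variable P : {measure set T -> \bar R}.
Hypothesis P1 : P setT = 1%E.
Implicit Types (x y : T -> borel_rV R n).

Lemma Rintegral_indic (A : set T) : measurable A ->
  (\int[P]_t (\1_A t : R))%R = fine (P A).
Proof. by move=> mA; rewrite /Rintegral integral_indic // setIT. Qed.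

Lemma Rintegral_cvg (f_ : nat -> T -> R) (f : T -> R) (M : R) :
  (forall N, measurable_fun setT (f_ N)) ->
  (forall N t, `|f_ N t| <= M) -> (forall t, f_ ^~ t @ \oo --> f t) ->
  \int[P]_t f_ N t @[N --> \oo] --> \int[P]_t f t.
Proof.
move=> mf fM ff.
have mf' : measurable_fun setT f.
  by apply: (@measurable_fun_cvg _ _ _ setT f_) => // t _; exact: ff.
have Pfin : (P setT < +oo)%E by rewrite P1 ltry.
have IM : P.-integrable setT (EFin \o cst M).
  by apply: (@bounded_integrable _ _ _ _ _ `|M|).
have [] := @dominated_convergence _ _ _ P setT measurableT
  (fun N => EFin \o f_ N) (EFin \o f) (EFin \o cst M).
- by move=> N; apply/measurable_EFinP.
- exact/measurable_EFinP.
- by apply: aeW => t _; apply: cvg_EFin; [exact: nearW|exact: ff].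
- exact: IM.
- by apply: aeW => t N _ /=; rewrite lee_fin.
move=> If _ cvgI; apply: fine_cvg.
by rewrite fineK //; exact: integrable_fin_num.
Qed.

(** The indicator of a set { p < 0 for all p in s } is a bounded pointwise limit of
    polynomials on the box of radius r, so its expectation is determined by the
    moments; these sets form a pi-system that generates the Borel sets. *)
Theorem moments_determine_law x y r :
  (forall i, measurable_fun setT (fun t => x t ord0 i)) ->
  (forall i, measurable_fun setT (fun t => y t ord0 i)) ->
  (forall t i, `|x t ord0 i| <= r) -> (forall t i, `|y t ord0 i| <= r) ->
  (forall f : mpoly n R, \int[P]_t peval f (x t) = \int[P]_t peval f (y t)) ->
  forall A : set (borel_rV R n), measurable A -> P (x @^-1` A) = P (y @^-1` A).
Proof.
move=> mx my xr yr xy.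
have mx' := measurable_fun_rV mx; have my' := measurable_fun_rV my.
have xy_neg s : P (x @^-1` negativity_set s) = P (y @^-1` negativity_set s).
  have [C [C0 Cx Cy]] : exists C, [/\ 0 < C,
      forall p t, p \in s -> `|peval p (x t)| <= C &
      forall p t, p \in s -> `|peval p (y t)| <= C].
    elim: s => [|p s [C [C0 Cx Cy]]]; first by exists 1.
    have [M pM] := meval_bounded r p.
    exists (C + `|M|); split; first by rewrite ltr_wpDr.
      move=> q t; rewrite in_cons => /orP[/eqP->|qs].
        apply: le_trans (pM _ (xr t)) _; apply: le_trans (ler_norm _) _.
        by rewrite lerDr ltW.
      by apply: le_trans (Cx q t qs) _; rewrite lerDl.
    move=> q t; rewrite in_cons => /orP[/eqP->|qs].
      apply: le_trans (pM _ (yr t)) _; apply: le_trans (ler_norm _) _.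
      by rewrite lerDr ltW.
    by apply: le_trans (Cy q t qs) _; rewrite lerDl.
  (* u p maps the values of p in [-C, C] to [0, 1], with u p < 1/2 iff p < 0 *)
  pose u (p : mpoly n R) := mpolyC n (1 / 2) + mpolyC n (2 * C)^-1 * p.
  pose F N := \prod_(p <- s) (1 - u p ^+ (2 * N)) ^+ step_exp N.
  have uE p z : peval (u p) z = 1 / 2 + (2 * C)^-1 * peval p z.
    by rewrite /peval /u mevalD mevalM !mevalC.
  have FE N z : peval (F N) z =
      \prod_(p <- s) (1 - peval (u p) z ^+ (2 * N)) ^+ step_exp N.
    rewrite /F /peval rmorph_prod; apply: eq_bigr => p _.
    by rewrite rmorphXn rmorphB rmorph1 rmorphXn.
  have lim (z : T -> borel_rV R n) :
      (forall i, measurable_fun setT (fun t => z t ord0 i)) ->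
      (forall p t, p \in s -> `|peval p (z t)| <= C) ->
      \int[P]_t peval (F N) (z t) @[N --> \oo] --> fine (P (z @^-1` negativity_set s)).
    move=> mz zC.
    have mzs : measurable (z @^-1` negativity_set s).
      exact: measurable_negativity_comp.
    have u01 p t : p \in s -> 0 <= peval (u p) (z t) <= 1.
      move=> /zC - /(_ t); rewrite ler_norml uE => /andP[l h].
      have c0 : 0 < (2 * C)^-1 by rewrite invr_gt0 mulr_gt0.
      have cC : (2 * C)^-1 * C = 1 / 2 by field; rewrite gt_eqF.
      have := ler_wpM2l (ltW c0) l; have := ler_wpM2l (ltW c0) h.
      by rewrite mulrN cC => ? ?; apply/andP; split; lra.
    rewrite -Rintegral_indic //.
    apply: (@Rintegral_cvg (fun N t => peval (F N) (z t)) _ 1) => [N|N t|t].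
    - exact: measurable_meval.
    - rewrite FE ger0_norm.
        rewrite big_seq; apply: prodr_ile1 => p /(u01 _ t)/andP[a0 a1].
        have b1 := exprn_ile1 (2 * N) a0 a1; have b0 := exprn_ge0 (2 * N) a0.
        by rewrite exprn_ge0 ?exprn_ile1 ?gerBl ?subr_ge0.
      rewrite big_seq; apply: prodr_ge0 => p /(u01 _ t)/andP[a0 a1].
      by rewrite exprn_ge0 // subr_ge0 exprn_ile1.
    under eq_fun do rewrite FE.
    have -> : \1_(z @^-1` negativity_set s) t =
        \prod_(p <- s) (peval (u p) (z t) < 1 / 2)%R%:R :> R.
      have uneg p : (peval (u p) (z t) < 1 / 2) = (peval p (z t) < 0).
        by rewrite uE gtrDl pmulr_rlt0 // invr_gt0 mulr_gt0.
      rewrite indicE; have [/allP sneg|sneg] :=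
        boolP (all (fun p => peval p (z t) < 0) s).
        rewrite mem_set // big_seq big1 // => p ps.
        by rewrite uneg sneg.
      rewrite memNset; last by move=> zs; case/negP: sneg; apply/allP.
      apply/esym/eqP; rewrite prodf_seq_eq0; apply/hasP.
      have /hasP[p ps pneg] : has (fun p => ~~ (peval p (z t) < 0)) s.
        by rewrite has_predC.
      by exists p => //=; rewrite uneg (negbTE pneg).
    apply: cvg_prod => p ps; apply: step_cvg; exact: u01.
  have fineq : fine (P (x @^-1` negativity_set s)) = fine (P (y @^-1` negativity_set s)).
    apply: (@cvg_unique _ _ (fmap (fun N => \int[P]_t peval (F N) (x t)) \oo)) => //.
      exact: lim.
    have -> : (fun N => \int[P]_t peval (F N) (x t)) =
        (fun N => \int[P]_t peval (F N) (y t)) by apply/funext => N; exact: xy.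
    exact: lim.
  have Pfin (A : set T) : measurable A -> P A \is a fin_num.
    move=> mA; rewrite ge0_fin_numE //; apply: (@le_lt_trans _ _ (P setT)).
      by apply: le_measure; rewrite ?inE.
    by rewrite P1 ltry.
  rewrite -[LHS]fineK ?fineq ?fineK //; apply: Pfin; exact: measurable_negativity_comp.
move=> A mA.
have [m1 m1E _] := law_exists P mx'; have [m2 m2E _] := law_exists P my'.
rewrite -m1E -m2E.
apply: (g_sigma_algebra_measure_unique
  [set negativity_set s | s in [set: seq (mpoly n R)]] _ (fun=> setT)).
- by move=> _ [s _ <-]; exact: measurable_negativity_set.
- by move=> _; exists [::] => //; apply/seteqP; split.
- by apply/seteqP; split => // z _; exists 0%N.
- move=> _ _ [s _ <-] [s' _ <-]; exists (s ++ s') => //.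
  apply/seteqP; split => z /=.
    move=> zs; split => p ps; apply: zs; rewrite mem_cat ps ?orbT //.
  by move=> [zs zs'] p; rewrite mem_cat => /orP[]; [exact: zs|exact: zs'].
- by move=> _ [s _ <-]; rewrite m1E m2E; exact: xy_neg.
- by move=> _; rewrite m1E preimage_setT P1 ltry.
exact: sigma_negativity_set.
Qed.

End Law.

(** * The measure of a positive functional *)

Section Support.
Context d (T : measurableType d) (R : realType) (n : nat).
Variables (P : {measure set T -> \bar R}) (x : T -> borel_rV R n) (r : R).
Hypothesis P1 : P setT = 1%E.
Hypothesis mx : forall i, measurable_fun setT (fun t => x t ord0 i).
Hypothesis x_le : forall t i, `|x t ord0 i| <= r.

(** Let G bound |g|. On { g <= - c } the factor (1 - g / G)^2N grows at least
    linearly in N, while it is at most 1 where g >= 0. Hence a set { g <= - c } of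
    positive measure would make the integral of g (1 - g / G)^2N negative for
    large N. *)
Lemma negative_part_null (g : mpoly n R) :
  (forall q, 0 <= \int[P]_t peval (g * q ^+ 2) (x t)) ->
  P (x @^-1` negativity_set [:: g]) = 0%E.
Proof.
move=> gq; have [M gM] := meval_bounded r g.
pose G := `|M| + 1.
have G0 : 0 < G by rewrite ltr_wpDl.
have iG : 0 <= G^-1 by rewrite invr_ge0 ltW.
have vG t : `|peval g (x t)| <= G.
  apply: le_trans (gM _ (x_le t)) _; apply: le_trans (ler_norm _) _.
  by rewrite lerDl.
have mg (q : mpoly n R) : measurable_fun setT (fun t => peval q (x t)).
  exact: measurable_meval.
have int_peval (q : mpoly n R) : P.-integrable setT (EFin \o (fun t => peval q (x t))).
  exact: (integrable_meval P1 mx x_le).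
pose A c := [set t | peval g (x t) <= - c].
have mA c : measurable (A c).
  rewrite -[A c]setTI; apply: (measurable_fun_ler (mg g) (measurable_cst (- c))) => //.
have PA c : 0 < c -> P (A c) = 0%E.
  move=> c0.
  have PAfin : P (A c) \is a fin_num.
    rewrite ge0_fin_numE //; apply: (@le_lt_trans _ _ (P setT)).
      by apply: le_measure; rewrite ?inE.
    by rewrite P1 ltry.
  have int_indic : P.-integrable setT (EFin \o (\1_(A c) : T -> R)).
    apply: (@bounded_integrable _ _ _ _ _ 1) => //; first by rewrite P1 ltry.
    by move=> t; rewrite indicE; case: (_ \in _); rewrite ?normr1 ?normr0.
  have bound N : (c + N%:R * (c ^+ 2 / G)) * fine (P (A c)) <= G.
    set K := c + _.
    have int_K : P.-integrable setT (EFin \o (fun t => K * \1_(A c) t)).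
      by have := integrableZl measurableT K int_indic.
    have int_G : P.-integrable setT (EFin \o cst G).
      by apply: (@bounded_integrable _ _ _ _ _ `|G|) => //; rewrite P1 ltry.
    have : 0 <= \int[P]_t (G - K * \1_(A c) t).
      apply: le_trans (gq ((1 - mpolyC n G^-1 * g) ^+ N)) _.
      apply: le_Rintegral => //.
        by have := integrableB measurableT int_G int_K.
      have pevalX (q : mpoly n R) m z : peval (q ^+ m) z = peval q z ^+ m.
        exact: rmorphXn.
      have peval_s z : peval (1 - mpolyC n G^-1 * g) z = 1 - G^-1 * peval g z.
        by rewrite /peval mevalB meval1 mevalM mevalC.
      move=> t _; rewrite {1}/peval mevalM -!/(peval _ _) !pevalX peval_s.
      have := vG t; move: (mA c).
      have -> : \1_(A c) t = (peval g (x t) <= - c)%R%:R :> R.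
        rewrite indicE; case: (leP (peval g (x t)) (- c)) => h.
          by rewrite mem_set.
        by rewrite memNset //=; apply/negP; rewrite -ltNge.
      move: (peval g (x t)) => v _ vG'.
      have Gv : -1 <= G^-1 * v <= 1.
        by rewrite -ler_norml normrM (ger0_norm iG) ler_pdivrMl // mulr1.
      have s0 : 0 <= 1 - G^-1 * v by case/andP: Gv => ? ?; lra.
      rewrite -exprM; case: (leP v (- c)) => vc.
        have h : 1 + (N * 2)%:R * (- (G^-1 * v)) <= (1 - G^-1 * v) ^+ (N * 2).
          by apply: bernoulli_ineq; case/andP: Gv => ? ?; lra.
        have w0 : 0 <= (1 - G^-1 * v) ^+ (N * 2) by rewrite exprn_ge0.
        have vc' : c / G <= - (G^-1 * v).
          by rewrite mulrC -mulrN ler_wpM2l // lerNr.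
        have cG : 0 <= c / G by rewrite divr_ge0 // ltW.
        have h1 : 1 + N%:R * (c / G) <= (1 - G^-1 * v) ^+ (N * 2).
          apply: le_trans h; rewrite lerD2l; apply: ler_pM => //.
          by rewrite ler_nat leq_pmulr.
        have h2 := ler_wpM2r w0 vc; have h3 := ler_wpM2l (ltW c0) h1.
        have KE : K = c * (1 + N%:R * (c / G)) by rewrite /K expr2; ring.
        move: h3; rewrite -KE mulr1; move: h2; rewrite mulNr.
        move: (c * _ ^+ _) => b h2 h3; apply: le_trans h2 _; lra.
      rewrite mulr0 subr0; have [v0|v0] := leP v 0.
        by apply: le_trans (ltW G0); rewrite mulr_le0_ge0 // exprn_ge0.
      apply: (@le_trans _ _ v); last by apply: le_trans (ler_norm _) vG'.
      have Gv0 : 0 <= G^-1 * v by rewrite mulr_ge0 // ltW.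
      by rewrite (ler_piMr (ltW v0)) // exprn_ile1 // gerBl.
    rewrite RintegralB // Rintegral_cst // RintegralZl // Rintegral_indic //.
    by rewrite P1 mulr1 subr_ge0.
  apply/eqP; rewrite -(fineK PAfin) eqe eq_le fine_ge0 // andbT leNgt; apply/negP => p0.
  set a := fine _ in bound p0.
  have b0 : 0 < c ^+ 2 / G * a by rewrite mulr_gt0 // divr_gt0 // exprn_gt0.
  have := archi_boundP (divr_ge0 (ltW G0) (ltW b0)); set N := Num.bound _.
  rewrite ltr_pdivrMr // => GN; have := bound N; rewrite leNgt => /negP; apply.
  apply: lt_le_trans GN _; 
  have -> : (c + N%:R * (c ^+ 2 / G)) * a = c * a + N%:R * (c ^+ 2 / G * a) by ring.
  by rewrite lerDr mulr_ge0 // ltW.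
have -> : x @^-1` negativity_set [:: g] = \bigcup_k A k.+1%:R^-1.
  apply/seteqP; split => t /=.
    move=> /(_ g); rewrite mem_head => /(_ isT) v0.
    have pv : 0 < - peval g (x t) by rewrite oppr_gt0.
    exists (Num.bound (- peval g (x t))^-1) => //=.
    rewrite /A /= lerNr -[leRHS]invrK lef_pV2 ?posrE ?invr_gt0 ?ltr0n //.
    apply: ltW; apply: lt_trans (archi_boundP _) _; first by rewrite invr_ge0 ltW.
    by rewrite ltr_nat.
  move=> [k _ vk] p; rewrite inE => /eqP ->; apply: le_lt_trans vk _.
  by rewrite oppr_lt0 invr_gt0.
apply/negligibleP; first by apply: bigcupT_measurable => k; exact: mA.
apply: negligible_bigcup => k; apply/negligibleP; first exact: mA.
by apply: PA; rewrite invr_gt0.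
Qed.

End Support.

Lemma map_evalE (R : realType) (n : nat) (T : 'I_n -> mpoly n R) (f : mpoly n R) z :
  peval f (map_eval T z) = peval (comp_mpoly [tuple T i | i < n] f) z.
Proof.
rewrite /peval comp_mpoly_meval; apply: meval_eq => i.
by rewrite tnth_mktuple /map_eval mxE.
Qed.

Lemma comp_mpoly_map_pow (R : realType) (n : nat) (T : 'I_n -> mpoly n R) a :
  comp_mpoly [tuple T i | i < n] (mpolyX R a) = map_pow T a.
Proof.
by rewrite comp_mpolyX; apply: eq_bigr => i _; rewrite tnth_mktuple.
Qed.

Section Representation.
Variables (R : realType) (n ng : nat) (g : 'I_ng -> mpoly n R).

Lemma basic_setC :
  ~` basic_set g = \bigcup_i negativity_set [:: g i] :> set (borel_rV R n).
Proof.
apply/seteqP; split => x /=.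
  move=> /existsNP[i /negP]; rewrite -ltNge => gi.
  by exists i => // p; rewrite inE => /eqP ->.
move=> [i _ gi] /(_ i); rewrite leNgt => /negP; apply; apply: gi.
by rewrite mem_head.
Qed.

Lemma measurable_basic_setC : measurable (~` basic_set g : set (borel_rV R n)).
Proof.
rewrite basic_setC; apply: countable_bigcupT_measurable => // i.
exact: measurable_negativity_set.
Qed.

Lemma measurable_basic_set : measurable (basic_set g : set (borel_rV R n)).
Proof. by rewrite -[basic_set g]setCK; apply: measurableC measurable_basic_setC. Qed.

Variables (L : {scalar mpoly n R}) (r : R).
Hypothesis n_gt0 : (0 < n)%N.
Hypothesis X_compact : compact (basic_set g).
Hypothesis r_gt0 : 0 < r.
Hypothesis L1 : L 1 = 1.
Hypothesis L_sqr : forall q, 0 <= L (q ^+ 2).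
Hypothesis L_growth : forall a, `|L (mpolyX R a)| <= r ^+ mdeg a.
Hypothesis L_loc : forall i q, 0 <= L (g i * q ^+ 2).

(** Growth and positivity on squares give a random vector x in the cube of radius r
    whose moments are the values of L. Positivity of L on g_i q^2 confines x to
    the set where g_i >= 0. If L is invariant on monomials then T x and x have the
    same moments, hence the same law. *)
Theorem moment_functional_measure :
  exists mu : {measure set (borel_rV R n) -> \bar R},
  [/\ supported g mu,
      forall f, (\int[mu]_(z in basic_set g) (peval f z)%:E = (L f)%:E)%E &
      forall T : 'I_n -> mpoly n R,
        (forall a, L (map_pow T a) = L (mpolyX R a)) ->
        forall A : set (borel_rV R n), measurable A ->
          mu (map_eval T @^-1` A) = mu A].
Proof.
have [h [mh hr hL]] : exists h : measurableTypeR R -> 'I_n -> R,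
    [/\ forall i, measurable_fun setT (h ^~ i), forall t i, `|h t i| <= r &
      forall f, \int[unit_measure R]_t meval (h t) f = L f].
  case: n n_gt0 L L1 L_sqr L_growth => // n' _ L' L1' Lsqr Lgrowth.
  exact: (exponential_growth_moment r_gt0 Lsqr Lgrowth L1').
pose x (t : measurableTypeR R) : borel_rV R n := \row_i h t i.
pose P := unit_measure R.
have P1 : P setT = 1%E := unit_measureT R.
have xE t i : x t ord0 i = h t i by rewrite mxE.
have mx i : measurable_fun setT (fun t => x t ord0 i).
  by under eq_fun do rewrite xE; exact: mh.
have xr t i : `|x t ord0 i| <= r by rewrite xE.
have xL f : \int[P]_t peval f (x t) = L f.
  by rewrite -hL; apply: eq_Rintegral => t _; apply: meval_eq => i; exact: xE.
have mxx := measurable_fun_rV mx.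
have [mu muE muI] := law_exists P mxx.
have muC0 : mu (~` basic_set g) = 0%E.
  rewrite muE; apply: measure_negligible.
    by have := mxx measurableT _ measurable_basic_setC; rewrite setTI.
  have ae_ge0 : {ae P, forall t, forall i, ~ negativity_set [:: g i] (x t)}.
    apply: filter_forall => i; exists (x @^-1` negativity_set [:: g i]); split.
    - exact: measurable_negativity_comp.
    - by apply: (negative_part_null P1 mx xr) => q; rewrite xL.
    - by move=> t /= /contrapT.
  apply: negligibleS ae_ge0 => t; rewrite basic_setC => -[i _ gi] /=.
  by move=> /(_ i); apply.
exists mu; split.
- move=> z zsupp; apply: contrapT => zX.
  have := zsupp (~` basic_set g); rewrite muC0 ltxx => /(_ _ zX) H.
  have : false by apply: H; rewrite openC; exact: compact_closed.
  by [].
- move=> f.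
  have Pf := integrable_meval P1 mx xr f.
  have mf : measurable_fun setT (fun z : borel_rV R n => (peval f z)%:E).
    by apply/measurable_EFinP; exact: measurable_peval.
  have [If Ef] := muI (fun z => (peval f z)%:E) mf Pf.
  rewrite -[basic_set g]setCK -setTD.
  rewrite -(negligible_integral measurable_basic_setC measurableT If muC0) Ef -xL.
  by rewrite /Rintegral fineK //; exact: integrable_fin_num.
move=> T LT A mA.
have [M MT] := choice (fun i => meval_bounded r (T i)).
pose y t : borel_rV R n := map_eval T (x t).
have yE t i : y t ord0 i = peval (T i) (x t) by rewrite /y /map_eval mxE.
have rle : r <= r + \sum_i `|M i| by rewrite lerDl sumr_ge0.
have LTf f : L (comp_mpoly [tuple T i | i < n] f) = L f.
  elim/mpolyind: f => [|c m p _ _ IHp]; first by rewrite comp_mpoly0.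
  have lin (q q' : mpoly n R) : L (c *: q + q') = c * L q + L q' by rewrite linearP.
  by rewrite comp_mpolyD comp_mpolyZ !lin IHp comp_mpoly_map_pow LT.
have mTA : measurable (map_eval T @^-1` A : set (borel_rV R n)).
  have mT : measurable_fun setT (map_eval T : borel_rV R n -> borel_rV R n).
    apply: measurable_fun_rV => i; under eq_fun do rewrite /map_eval mxE.
    exact: measurable_peval.
  by have := mT measurableT _ mA; rewrite setTI.
rewrite !muE -[x @^-1` (_ @^-1` _)]/(y @^-1` A); apply/esym.
apply: (moments_determine_law P1 (r := r + \sum_i `|M i|)) => //.
- by move=> i; under eq_fun do rewrite yE; exact: measurable_meval.
- by move=> t i; apply: le_trans rle.
- move=> t i; rewrite yE; apply: le_trans (MT i _ (xr t)) _.
  apply: le_trans (ler_norm _) _; rewrite (bigD1 i) //= addrCA lerDl.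
  by apply: addr_ge0; [exact: ltW|exact: sumr_ge0].
move=> f; rewrite xL.
by under eq_Rintegral do rewrite /y map_evalE; rewrite xL LTf.
Qed.

End Representation.

(** * Truncated moment sequences *)

Section Riesz.
Variables (R : realType) (n d : nat).
Implicit Types (z : truncseq R n d).

Lemma riesz_is_linear z : scalar (riesz z).
Proof.
move=> c f h; rewrite /riesz mulr_sumr -big_split /=; apply: eq_bigr => a _.
by rewrite mcoeffD mcoeffZ mulrDl mulrA.
Qed.

HB.instance Definition _ z :=
  GRing.isLinear.Build R (mpoly n R) R *%R (riesz z) (riesz_is_linear z).

Lemma riesz_monomial z (a : bmultinom n d.+1) : riesz z (mpolyX R a) = z a.
Proof.
rewrite /riesz (bigD1 a) //= mcoeffX eqxx mul1r big1 ?addr0 // => b ba.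
by rewrite mcoeffX -bmeqP eq_sym (negbTE ba) mul0r.
Qed.

Lemma extend_riesz z (a : multinom n) : (mdeg a <= d)%N ->
  extend z a = riesz z (mpolyX R a).
Proof.
move=> ad; rewrite /extend; case: insubP => [b _ <-|]; first by rewrite riesz_monomial.
by rewrite ltnS ad.
Qed.

Lemma riesz_loc_mx z (p : mpoly n R)
    (v : 'rV[R]_(#|{: bmultinom n (loc_deg d p).+1}|)) :
  (v *m loc_mx p z *m v^T) ord0 ord0 =
  riesz z (p * (\sum_j v ord0 j *: mpolyX R (bmnm (enum_val j))) ^+ 2).
Proof.
rewrite mxE.
transitivity (\sum_j \sum_i v ord0 j * (v ord0 i *
    riesz z (p * mpolyX R (bmnm (enum_val i)) * mpolyX R (bmnm (enum_val j))))).
  apply: eq_bigr => j _; rewrite !mxE mulr_suml; apply: eq_bigr => i _.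
  by rewrite !mxE mulrC mulrA.
rewrite expr2 mulrA mulr_sumr linear_sum; apply: eq_bigr => j _.
rewrite -scalerAr linearZ -mulr_sumr; congr (_ * _).
rewrite mulr_sumr mulr_suml linear_sum; apply: eq_bigr => i _.
by rewrite -scalerAr -scalerAl linearZ.
Qed.

Lemma psd_loc_mx z (p q : mpoly n R) : psd_mx (loc_mx p z) ->
  (mmeasure mdeg q <= (loc_deg d p).+1)%N -> 0 <= riesz z (p * q ^+ 2).
Proof.
move=> [_ psd] qd; have := psd (\row_j mcoeff (bmnm (enum_val j)) q).
rewrite riesz_loc_mx; set s := \sum_j _; suff -> : s = q by [].
rewrite {}/s.
rewrite [RHS](mpolywE qd) [RHS](reindex_onto enum_val enum_rank) /=; last first.
  by move=> b _; rewrite enum_rankK.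
by apply: eq_big => [j|j _]; rewrite ?enum_valK ?eqxx // mxE.
Qed.

End Riesz.

Section RelaxationBounds.
Variables (R : realType) (n ng : nat).
Variables (T : 'I_n -> mpoly n R) (g : 'I_ng -> mpoly n R).
Hypothesis degT : (1 <= map_deg T)%N.

Lemma leq_relax_deg k : (k <= relax_deg T k)%N.
Proof. by rewrite /relax_deg leq_pmulr. Qed.

(** Positivity at a fixed square is implied by all relaxations of large order, so
    that no degrees have to be tracked in the passage to the limit: each argument
    applies finitely many such statements and holds for all large k. *)
Lemma R_feasible_loc k (z : truncseq R n (relax_deg T k)) i q :
  R_feasible g z -> (pdeg (constr g i) + 2 * mmeasure mdeg q <= k)%N ->
  0 <= riesz z (constr g i * q ^+ 2).
Proof.
move=> [_ _ psd] kd.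
have dk : (pdeg (constr g i) + 2 * mmeasure mdeg q <= relax_deg T k)%N.
  exact: leq_trans kd (leq_relax_deg k).
apply: psd_loc_mx; first by apply: psd; apply: leq_trans dk; exact: leq_addr.
apply: leqW; rewrite /loc_deg geq_half_double -mul2n.
by rewrite leq_subRL //; apply: leq_trans dk; exact: leq_addr.
Qed.

Variable z : forall k, truncseq R n (relax_deg T k).
Arguments z k : clear implicits.
Hypothesis z_feas : \forall k \near \oo, R_feasible g (z k).

Lemma near_loc_ge0 i q : \forall k \near \oo, 0 <= riesz (z k) (constr g i * q ^+ 2).
Proof.
near=> k; apply: R_feasible_loc; first by near: k.
by near: k; exact: nbhs_infty_ge.
Unshelve. all: by end_near. Qed.

Lemma near_sqr_ge0 q : \forall k \near \oo, 0 <= riesz (z k) (q ^+ 2).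
Proof.
have := near_loc_ge0 ord0 q; apply: filterS => k.
by rewrite /constr unlift_none mul1r.
Qed.

Lemma near_sos_loc_ge0 i p q : is_sos p ->
  \forall k \near \oo, 0 <= riesz (z k) (p * constr g i * q ^+ 2).
Proof.
move=> [s ->]; elim: s => [|t s IHs].
  by apply: nearW => k; rewrite big_nil !mul0r linear0.
rewrite big_cons; near=> k.
rewrite !mulrDl linearD; apply: addr_ge0; last by near: k.
rewrite (_ : _ * _ * _ = constr g i * (t * q) ^+ 2); last by ring.
by near: k; exact: near_loc_ge0.
Unshelve. all: by end_near. Qed.

Hypothesis g_arch : is_archimedean g.

Let X i : mpoly n R := mpolyX R (mnm1 i).

(** The Archimedean identity times q^2 is a sum of squares times constraints, so
    the functional is nonnegative on (r^2 - X_1^2 - ... - X_n^2) q^2; the squares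
    of the other variables can be dropped. Replacing r by |r| + 1 makes the bound
    positive. *)
Lemma near_multiplication_bound : exists2 rho, 0 < rho & forall i q,
  \forall k \near \oo,
    riesz (z k) ((X i * q) ^+ 2) <= rho ^+ 2 * riesz (z k) (q ^+ 2).
Proof.
have [r [sigma [sos_sigma archE]]] := g_arch.
exists (`|r| + 1) => [|i q]; first by rewrite ltr_wpDl.
have near_ball : \forall k \near \oo, 0 <= riesz (z k)
    ((mpolyC n (r ^+ 2) - \sum_(j < n) X j ^+ 2) * q ^+ 2).
  have : \forall k \near \oo, forall j, 0 <= riesz (z k)
      (sigma j * constr g j * q ^+ 2).
    by apply: filter_forall => j; exact: near_sos_loc_ge0.
  apply: filterS => k jk; rewrite archE mulr_suml linear_sum.
  by apply: sumr_ge0 => j _; exact: jk.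
have near_squares : \forall k \near \oo, forall j, 0 <= riesz (z k) ((X j * q) ^+ 2).
  by apply: filter_forall => j; exact: near_sqr_ge0.
near=> k.
have ball : 0 <= riesz (z k) ((mpolyC n (r ^+ 2) - \sum_(j < n) X j ^+ 2) * q ^+ 2).
  by near: k.
have squares j : 0 <= riesz (z k) ((X j * q) ^+ 2) by move: j; near: k.
have q0 : 0 <= riesz (z k) (q ^+ 2) by near: k; exact: near_sqr_ge0.
apply: (@le_trans _ _ (r ^+ 2 * riesz (z k) (q ^+ 2))).
  move: ball; rewrite mulrBl linearB mul_mpolyC linearZ subr_ge0.
  apply: le_trans; rewrite mulr_suml linear_sum (bigD1 i) //= exprMn lerDl.
  by apply: sumr_ge0 => j _; rewrite -exprMn.
apply: ler_wpM2r => //; rewrite -(real_normK (num_real r)).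
by have := normr_ge0 r; move: `|r| => s s0; rewrite !expr2; lra.
Unshelve. all: by end_near. Qed.

(** Removing one variable at a time bounds the moments of even exponents; those of
    arbitrary exponents follow from positivity on (rho^m + x^a)^2 and
    (rho^m - x^a)^2, where m is the degree of x^a. *)
Lemma near_growth : exists2 rho, 0 < rho & forall a,
  \forall k \near \oo, `|riesz (z k) (mpolyX R a)| <= rho ^+ mdeg a.
Proof.
have [rho rho0 mulb] := near_multiplication_bound.
have riesz1 : \forall k \near \oo, riesz (z k) 1 = 1.
  apply: filterS z_feas => k [_ z1 _].
  by rewrite -mpolyX0 -[RHS]z1; exact: (riesz_monomial (z k) bm0).
have even_growth m : forall a, mdeg a = m ->
    \forall k \near \oo, riesz (z k) (mpolyX R a ^+ 2) <= rho ^+ m ^+ 2.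
  elim: m => [|m IHm] a am.
    apply: filterS riesz1 => k z1.
    have /eqP -> : a == mnm0 by rewrite -mdeg_eq0 am.
    by rewrite mpolyX0 expr1n expr0 expr1n z1.
  have [i ai] : exists i, a i != 0%N.
    apply/existsP; apply: contraT; rewrite negb_exists => /forallP a0.
    have : mdeg a = 0%N.
      by rewrite mdegE big1 // => i _; apply/eqP; move: (a0 i); rewrite negbK.
    by rewrite am.
  pose b := mnm_sub a (mnm1 i).
  have ab : a = mnm_add b (mnm1 i) by rewrite submK // lep1mP.
  have bm : mdeg b = m by move: am; rewrite {1}ab mdegD mdeg1 addn1 => -[].
  near=> k; rewrite ab mpolyXD mulrC.
  apply: (@le_trans _ _ (rho ^+ 2 * riesz (z k) (mpolyX R b ^+ 2))).
    by near: k; exact: mulb.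
  rewrite [rho ^+ m.+1]exprS exprMn ler_wpM2l ?sqr_ge0 //.
  by near: k; exact: IHm.
exists rho => // a; set e := rho ^+ mdeg a.
have e0 : 0 < e by rewrite exprn_gt0.
near=> k.
have z1 : riesz (z k) 1 = 1 by near: k.
have h1 : riesz (z k) (mpolyX R a ^+ 2) <= e ^+ 2 by near: k; exact: even_growth.
have h2 : 0 <= riesz (z k) ((mpolyC n e + mpolyX R a) ^+ 2).
  by near: k; exact: near_sqr_ge0.
have h3 : 0 <= riesz (z k) ((mpolyC n e - mpolyX R a) ^+ 2).
  by near: k; exact: near_sqr_ge0.
have E c : riesz (z k) ((mpolyC n e + mpolyC n c * mpolyX R a) ^+ 2) =
    e ^+ 2 + 2 * e * c * riesz (z k) (mpolyX R a) +
    c ^+ 2 * riesz (z k) (mpolyX R a ^+ 2).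
  have C b f : riesz (z k) (mpolyC n b * f) = b * riesz (z k) f.
    by rewrite mul_mpolyC linearZ.
  have -> : (mpolyC n e + mpolyC n c * mpolyX R a) ^+ 2 = mpolyC n (e ^+ 2) * 1 +
      mpolyC n (2 * e * c) * mpolyX R a + mpolyC n (c ^+ 2) * mpolyX R a ^+ 2.
    ring.
  have D f h : riesz (z k) (f + h) = riesz (z k) f + riesz (z k) h.
    by rewrite linearD.
  by rewrite !D !C z1 mulr1.
have := E 1; rewrite mpolyC1 mul1r => E1; rewrite E1 in h2.
have := E (- 1); rewrite mpolyCN mpolyC1 mulN1r => E2; rewrite E2 in h3.
have h4 : e * riesz (z k) (mpolyX R a) <= e * e by move: h1 h2 h3; rewrite !expr2; lra.
have h5 : e * - riesz (z k) (mpolyX R a) <= e * e.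
  by move: h1 h2 h3; rewrite !expr2; lra.
rewrite ler_pM2l // in h4; rewrite ler_pM2l // in h5.
by rewrite ler_norml h4 andbT lerNl.
Unshelve. all: by end_near. Qed.

Lemma near_bounded f : exists M, \forall k \near \oo, `|riesz (z k) f| <= M.
Proof.
have [rho _ growth] := near_growth.
elim/mpolyind: f => [|c a p _ _ [M IHp]].
  by exists 0; apply: nearW => k; rewrite linear0 normr0.
exists (`|c| * rho ^+ mdeg a + M); near=> k.
rewrite linearD linearZ; apply: le_trans (ler_normD _ _) _.
apply: lerD; last by near: k.
by rewrite normrM ler_wpM2l //; near: k; exact: growth.
Unshelve. all: by end_near. Qed.

Lemma riesz_ultralimit (U : set_system nat) : UltraFilter U -> \oo `<=` U ->
  exists L : {scalar mpoly n R}, forall f, riesz (z k) f @[k --> U] --> L f.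
Proof.
move=> UU infU.
have cvgU f : exists l : R, riesz (z k) f @[k --> U] --> l.
  have [M fM] := near_bounded f.
  exact: (@ultra_bounded_cvg _ _ U (fun k => riesz (z k) f) M UU (infU _ fM)).
have [L LP] := choice cvgU.
have Llin : scalar L.
  move=> c p q.
  apply: (@cvg_unique _ _ (fmap (fun k => riesz (z k) (c *: p + q)) U)) => //=.
  have -> : (fun k => riesz (z k) (c *: p + q)) =
      (fun k => c * riesz (z k) p + riesz (z k) q).
    by apply/funext => k; rewrite linearP.
  by apply: cvgD; [apply: cvgM; [exact: cvg_cst|exact: LP]|exact: LP].
pose LM := GRing.isLinear.Build R (mpoly n R) R *%R L Llin.
pose LL : {scalar mpoly n R} := HB.pack L LM.
by exists LL.
Qed.

End RelaxationBounds.

Section Degrees.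
Variables (R : realType) (n : nat).
Implicit Types f h : mpoly n R.
Local Notation size_le f d := (mmeasure mdeg f <= d.+1)%N.

Lemma size_le_mul f h d e : size_le f d -> size_le h e -> size_le (f * h) (d + e).
Proof.
have [->|f0] := eqVneq f 0; first by rewrite mul0r mmeasure0.
have [->|h0] := eqVneq h 0; first by rewrite mulr0 mmeasure0.
move=> fd he; rewrite msizeM // -subn1 leq_subLR add1n -addSn -addnS.
exact: leq_add.
Qed.

Lemma size_le_sum (I : Type) (s : seq I) (F : I -> mpoly n R) d :
  (forall i, size_le (F i) d) -> size_le (\sum_(i <- s) F i) d.
Proof.
move=> Fd; apply: (big_ind (fun f => size_le f d)) => [|f h fd hd|i _].
- by rewrite mmeasure0.
- by apply: leq_trans (mmeasureD_le _ _ _) _; rewrite geq_max fd hd.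
- exact: Fd.
Qed.

Lemma size_le_map_pow (T : 'I_n -> mpoly n R) a :
  size_le (map_pow T a) (mdeg a * map_deg T).
Proof.
have size_pow f m d : size_le f d -> size_le (f ^+ m) (m * d).
  move=> fd; elim: m => [|m IHm]; first by rewrite expr0 msize1.
  by rewrite exprS mulSn; exact: size_le_mul.
rewrite mdegE big_distrl /map_pow /=.
apply: (big_ind2 (fun f d => size_le f d)) => [|f d h e|i _].
- by rewrite msize1.
- exact: size_le_mul.
apply: size_pow; apply: leq_trans (leqSpred _) _; rewrite ltnS /map_deg.
exact: (@leq_bigmax 'I_n (fun i => pdeg (T i)) i).
Qed.

End Degrees.

Section Truncation.
Variables (R : realType) (n ng : nat) (g : 'I_ng -> mpoly n R).
Variables (mu : {measure set (borel_rV R n) -> \bar R}) (w : momseq R n).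
Hypothesis X_compact : compact (basic_set g).
Hypothesis mu_w : is_moment_seq g mu w.

Lemma peval_bounded (f : mpoly n R) :
  exists M, forall x, basic_set g x -> `|peval f x| <= M.
Proof.
have [r [_ Xr]] := compact_bounded X_compact.
have [M fM] := meval_bounded (r + 1) f.
exists M => x /Xr xr; apply: fM => i.
apply: (@le_trans _ _ `|x|); last by apply: xr; rewrite ltrDl.
by rewrite [leRHS]/Num.Def.normr /= mx_normrE; apply/bigmax_geP; right; exists (ord0, i).
Qed.

Let mX : measurable (basic_set g : set (borel_rV R n)) := measurable_basic_set g.

Lemma moment_mass : mu (basic_set g) = (w mnm0)%:E.
Proof.
rewrite mu_w; under eq_integral do rewrite mpolyX0 /peval meval1.
by rewrite integral_cst // mul1e.
Qed.

Lemma integrable_peval (f : mpoly n R) :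
  mu.-integrable (basic_set g) (fun x => (peval f x)%:E).
Proof.
apply: measurable_bounded_integrable => //.
- by rewrite moment_mass ltry.
- exact: measurable_funTS (measurable_peval f).
have [M fM] := peval_bounded f; exists M; split; first exact: num_real.
by move=> N MN x Xx /=; apply: le_trans (fM x Xx) (ltW MN).
Qed.

Lemma riesz_moment d (f : mpoly n R) : (mmeasure mdeg f <= d.+1)%N ->
  ((riesz (fun a : bmultinom n d.+1 => w a) f)%:E =
   \int[mu]_(x in basic_set g) (peval f x)%:E)%E.
Proof.
move=> fd; transitivity (\int[mu]_(x in basic_set g)
  (\sum_(a : bmultinom n d.+1) (mcoeff a f)%:E * (peval (mpolyX R a) x)%:E))%E.
  rewrite integral_sum //; last first.
    by move=> a; apply: integrableZl => //; exact: integrable_peval.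
  rewrite /riesz -sumEFin; apply: eq_bigr => a _.
  rewrite integralZl //; last exact: integrable_peval.
  by rewrite -mu_w.
apply: eq_integral => x _; rewrite [in RHS](mpolywE fd) /peval.
rewrite (raddf_sum (meval (x ord0))) -sumEFin.
by apply: eq_bigr => a _; rewrite -EFinM; congr _%:E; rewrite -[LHS]mevalZ.
Qed.

Lemma constr_ge0 i x : basic_set g x -> 0 <= peval (constr g i) x.
Proof.
rewrite /constr; case: (unliftP ord0 i) => [j _|_] Xx /=; first exact: Xx.
by rewrite /peval meval1.
Qed.

Lemma psd_loc_moment d i : (pdeg (constr g i) <= d)%N ->
  psd_mx (loc_mx (constr g i) (fun a : bmultinom n d.+1 => w a)).
Proof.
move=> id; split; first by apply/matrixP => a b; rewrite !mxE mulrAC.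
move=> v; rewrite riesz_loc_mx -lee_fin riesz_moment.
  apply: integral_ge0 => x Xx; rewrite lee_fin /peval mevalM rmorphXn.
  by rewrite mulr_ge0 ?sqr_ge0 // constr_ge0.
set e := loc_deg d (constr g i).
have ed : (pdeg (constr g i) + (e + e) <= d)%N.
  rewrite -leq_subRL // addnn -geq_half_double //.
have size_q :
    (mmeasure mdeg (\sum_j v ord0 j *: mpolyX R (bmnm (enum_val j))) <= e.+1)%N.
  apply: size_le_sum => j; apply: leq_trans (mmeasureZ_le _ _ _) _.
  by rewrite msizeX; exact: bmdeg.
apply: leq_trans (_ : (pdeg (constr g i) + (e + e)).+1 <= _)%N; last by [].
apply: size_le_mul; first exact: leqSpred.
by rewrite expr2; apply: size_le_mul.
Qed.

End Truncation.

(** T^a has degree at most |a| deg T, so for |a| <= k the Riesz functional of order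
    k deg T integrates it exactly: the constraints of the relaxation hold for the
    truncated moments of a measure. *)
Lemma truncation_feasible (R : realType) (n ng : nat) (T : 'I_n -> mpoly n R)
    (g : 'I_ng -> mpoly n R) (w : momseq R n) k :
  (1 <= map_deg T)%N -> compact (basic_set g) -> P_feasible T g w ->
  R_feasible g ((fun a => w a) : truncseq R n (relax_deg T k)).
Proof.
move=> degT cX [_ w0 [mu [_ mu_w muT]]]; split.
- move=> a; have ak : (mdeg a <= k)%N by rewrite -ltnS; exact: bmdeg.
  apply: EFin_inj; rewrite !(riesz_moment cX mu_w) ?muT //.
    by rewrite msizeX ltnS; apply: leq_trans ak (leq_relax_deg degT k).
  apply: leq_trans (size_le_map_pow _ _) _.
  by rewrite ltnS leq_mul2r ak orbT.
- exact: w0.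
- by move=> i id; exact: psd_loc_moment.
Qed.

(** * Convergence of the relaxations *)

(** Since there are only countably many moments, a pointwise limit along an
    ultrafilter is also a limit along a subsequence: the i-th index is chosen so
    that the first i moments are within 1 / (i + 1) of their limits. *)
Lemma ultralimit_subsequence (R : realType) (n : nat) (u : nat -> momseq R n)
    (y : momseq R n) (U : set_system nat) : UltraFilter U -> \oo `<=` U ->
  (forall a, u k a @[k --> U] --> y a) ->
  exists2 phi : nat -> nat, {homo phi : i j / (i < j)%N} &
    ptws_cvg (fun i => u (phi i)) y.
Proof.
move=> UU infU uy.
have close i N : exists k, (N < k)%N /\ forall j : 'I_i, forall a,
    unpickle j = Some a -> `|y a - u k a| <= i.+1%:R^-1.
  apply: (@filter_ex _ U); apply: filterI; first exact: infU _ (nbhs_infty_gt N).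
  apply: filter_forall => j; case: (unpickle j) => [a|]; last by apply: nearW.
  have /cvgrPdist_le/(_ i.+1%:R^-1) := uy a; rewrite invr_gt0 ltr0n => /(_ isT).
  by apply: filterS => k ya b [<-].
have [c cP] := choice (fun iN : nat * nat => close iN.1 iN.2).
pose phi := fix phi i := if i is j.+1 then c (i, phi j) else c (0%N, 0%N).
exists phi.
  apply: homo_ltn => [a b d|i]; first exact: ltn_trans.
  by have [] := cP (i.+1, phi i).
move=> a; have dist i : (pickle a < i)%N -> `|y a - u (phi i) a| <= i.+1%:R^-1.
  case: i => // i ai.
  by have [_ /(_ (Ordinal ai) a)] := cP (i.+1, phi i); apply; exact: pickleK.
apply/cvgrPdist_le => e e0; near=> i.
apply: le_trans (dist i _) _; first by near: i; exact: nbhs_infty_gt.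
have : `|0 - harmonic i| <= e.
  by near: i; have /cvgrPdist_le := @cvg_harmonic R; exact.
by rewrite sub0r normrN; apply: le_trans; exact: ler_norm.
Unshelve. all: by end_near. Qed.

(** This turns statements about all limits along ultrafilters into statements about
    the sequence itself: a property that fails infinitely often fails along some
    ultrafilter. *)
Lemma frequently_ultrafilter (B : set nat) :
  ~ (\forall k \near \oo, ~ B k) ->
  exists U, [/\ UltraFilter U, \oo `<=` U & U B].
Proof.
move=> nB.
have PB : ProperFilter (within B \oo).
  split; last exact: within_filter.
  by move=> h; apply: nB; apply: filterS h.
have [U [UU wU]] := ultraFilterLemma PB.
exists U; split => //.
  by move=> A Ainf; apply: wU; apply: filterS Ainf.
by apply: wU; exact: nearW.
Qed.

Lemma pointwise_cvg_momseq (R : realType) (n : nat) (I : Type) (U : set_system I)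
    (u : I -> momseq R n) (w : momseq R n) : Filter U ->
  (forall a, u k a @[k --> U] --> w a) -> u k @[k --> U] --> w.
Proof.
move=> FU uw; apply/cvg_sup => a A; rewrite nbhsE => -[B [[C oC <-] Cw] CA].
apply: (@filterS _ U _ (fun k => C (u k a))) => [k|]; first exact: CA.
exact: (uw a _ (open_nbhs_nbhs (conj oC Cw))).
Qed.

Section Convergence.
Variables (R : realType) (n ng : nat).
Variables (T : 'I_n -> mpoly n R) (g : 'I_ng -> mpoly n R) (F : momseq R n -> \bar R).
Variable y : forall k : nat, truncseq R n (relax_deg T k).
Arguments y k : clear implicits.
Hypothesis degT : (1 <= map_deg T)%N.
Hypothesis X_compact : compact (basic_set g).
Hypothesis g_arch : is_archimedean g.
Hypothesis F_gtNy : forall z, F z <> -oo%E.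
Hypothesis F_fin : finitely_determined F.
Hypothesis F_lsc : lower_semicontinuous F.
Hypothesis y_opt : \forall k \near \oo, R_optimal g F (y k).

Let y_feas : \forall k \near \oo, R_feasible g (y k).
Proof. by apply: filterS y_opt => k []. Qed.

(** The limit functional satisfies the constraints of all relaxations at once, and
    therefore is the moment functional of an invariant measure. *)
Lemma ultralimit_invariant (U : set_system nat) : UltraFilter U -> \oo `<=` U ->
  exists (mu : {measure set (borel_rV R n) -> \bar R}) (w : momseq R n),
  [/\ invariant_measure T g mu, is_moment_seq g mu w, P_feasible T g w &
      forall a, extend (y k) a @[k --> U] --> w a].
Proof.
move=> UU infU.
have [L yL] := riesz_ultralimit degT y_feas g_arch UU infU.
have [rho rho0 growth] := near_growth degT y_feas g_arch.
have L_eq f h : (\forall k \near \oo, riesz (y k) f = riesz (y k) h) -> L f = L h.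
  move=> fh; apply: (@cvg_unique _ _ (fmap (fun k => riesz (y k) f) U)) => //=.
  apply: cvg_trans (yL h); apply: near_eq_cvg; apply: infU.
  by apply: filterS fh => k ->.
have L_ge0 f : (\forall k \near \oo, 0 <= riesz (y k) f) -> 0 <= L f.
  move=> f0; rewrite -(cvg_lim _ (yL f)) //; apply: limr_ge; last exact: infU.
  by apply/cvg_ex; exists (L f); exact: yL.
have riesz1 : \forall k \near \oo, riesz (y k) 1 = 1.
  apply: filterS y_feas => k [_ z1 _].
  by rewrite -mpolyX0 -[RHS]z1; exact: (riesz_monomial (y k) bm0).
have L1 : L 1 = 1.
  apply: (@cvg_unique _ _ (fmap (fun k => riesz (y k) 1) U)) => //=.
  apply: cvg_near_cst; exact: infU.
have L_growth a : `|L (mpolyX R a)| <= rho ^+ mdeg a.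
  have yLn : `|riesz (y k) (mpolyX R a)| @[k --> U] --> `|L (mpolyX R a)|.
    exact: cvg_norm.
  rewrite -(cvg_lim _ yLn) //; apply: limr_le; last by apply: infU; exact: growth.
  by apply/cvg_ex; exists `|L (mpolyX R a)|.
have n_gt0 : (0 < n)%N.
  by move: degT; rewrite /map_deg; case: n T => // T'; rewrite big_ord0.
have L_loc i q : 0 <= L (g i * q ^+ 2).
  apply: L_ge0; have := near_loc_ge0 degT y_feas (lift ord0 i) q.
  by rewrite /constr liftK.
have [mu [mu_supp muL mu_inv]] := moment_functional_measure n_gt0 X_compact rho0 L1
  (fun q => L_ge0 _ (near_sqr_ge0 degT y_feas q)) L_growth L_loc.
have L_pow a : L (map_pow T a) = L (mpolyX R a).
  apply: L_eq; near=> k.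
  have [mom _ _] : R_feasible g (y k) by near: k.
  have ak : (mdeg a < k.+1)%N by rewrite ltnS; near: k; exact: nbhs_infty_ge.
  exact: (mom (BMultinom ak)).
pose w : momseq R n := fun a => L (mpolyX R a).
have mu_w : is_moment_seq g mu w by move=> a; rewrite muL.
have w0 : w mnm0 = 1 by rewrite /w mpolyX0.
exists mu, w; split.
- split; first exact: mu_supp.
  exact: mu_inv.
- exact: mu_w.
- split => //; exists mu; split => //.
  by move=> a; rewrite !muL L_pow.
move=> a; apply: cvg_trans (yL (mpolyX R a)); apply: near_eq_cvg; apply: infU.
near=> k; apply/esym/extend_riesz; apply: leq_trans (leq_relax_deg degT k).
by near: k; exact: nbhs_infty_ge.
Unshelve. all: by end_near. Qed.

Lemma ultralimit_value (U : set_system nat) (w : momseq R n) (c : R) :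
  UltraFilter U -> (forall a, extend (y k) a @[k --> U] --> w a) ->
  U [set k | (F (extend (y k)) <= c%:E)%E] -> (F w <= c%:E)%E.
Proof.
move=> UU yw Uc; rewrite leNgt; apply/negP => /F_lsc[V Vw VF].
have yV : U [set k | V (extend (y k))].
  by have := @pointwise_cvg_momseq R n nat U (fun k => extend (y k)) w _ yw; apply.
have [k [ck /VF]] := filter_ex (filterI Uc yV).
by rewrite ltNge ck.
Qed.

(** The truncation of w is feasible, and its value is that of w as soon as the
    coordinates on which F depends have degree at most k. *)
Lemma relaxation_le (w : momseq R n) : P_feasible T g w ->
  \forall k \near \oo, (F (extend (y k)) <= F w)%E.
Proof.
move=> wP; have [s sF] := F_fin.
near=> k.
have [_ opt] : R_optimal g F (y k) by near: k.
apply: le_trans (opt _ (truncation_feasible k degT X_compact wP)) _.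
rewrite le_eqVlt; apply/orP; left; apply/eqP; apply: sF => a sa.
rewrite /extend; case: insubP => [b _ <-//|]; rewrite ltnS => /negP[].
apply: leq_trans (leq_relax_deg degT k).
apply: (@leq_trans (\max_(b <- s) mdeg b)); first exact: leq_bigmax_seq.
by near: k; exact: nbhs_infty_ge.
Unshelve. all: by end_near. Qed.

Lemma ultralimit_optimal (U : set_system nat) (w : momseq R n) :
  UltraFilter U -> \oo `<=` U -> P_feasible T g w ->
  (forall a, extend (y k) a @[k --> U] --> w a) -> F w = P_value T g F.
Proof.
move=> UU infU wP yw; apply/eqP; rewrite eq_le; apply/andP; split; last first.
  by apply: ereal_inf_lbound; exists w.
apply: le_ereal_inf_tmp => _ [v vP <-].
have := relaxation_le vP; have := @F_gtNy v; case: (F v) => [c _ yc|_ _|//].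
  by apply: ultralimit_value yw _ => //; exact: infU.
exact: leey.
Qed.

Lemma relaxation_values_cvg : F (extend (y k)) @[k --> \oo] --> P_value T g F.
Proof.
have [U [UU infU]] := ultraFilterLemma eventually_filter.
have [_ [w [_ _ wP yw]]] := ultralimit_invariant UU infU.
have Fw := ultralimit_optimal UU infU wP yw.
have upper := relaxation_le wP.
have lower c : (c%:E < F w)%E -> \forall k \near \oo, (c%:E < F (extend (y k)))%E.
  move=> cw; apply: contrapT => nlow.
  have [|V [VV infV Vc]] :=
    @frequently_ultrafilter [set k | (F (extend (y k)) <= c%:E)%E].
    by move=> h; apply: nlow; apply: filterS h => k /negP; rewrite -ltNge.
  have [_ [v [_ _ vP yv]]] := ultralimit_invariant VV infV.
  have := ultralimit_value VV yv Vc.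
  by rewrite (ultralimit_optimal VV infV vP yv) -Fw leNgt cw.
rewrite -Fw; move: (@F_gtNy w) upper lower; case: (F w) => [r _|_|//] upper lower A.
  move=> rA; have /nbhs_ballP[e /= e0 eA] : nbhs r (fun v => A v%:E) by [].
  have re : ((r - e)%:E < r%:E)%E by rewrite lte_fin ltrBlDr ltrDl.
  apply: filterS2 upper (lower _ re) => k /=.
  case: (F _) => [v|//|//]; rewrite lee_fin lte_fin => vr rv; apply: eA.
  by rewrite -ball_normE /= ger0_norm ?subr_ge0 // ltrBlDl -ltrBlDr.
move=> [M [_ MA]].
by apply: filterS (lower M (ltry _)) => k; exact: MA.
Qed.

End Convergence.

Theorem theorem2 (R : realType) (n ng : nat)
    (T : 'I_n -> mpoly n R) (g : 'I_ng -> mpoly n R)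
    (F : momseq R n -> \bar R)
    (y : forall k : nat, truncseq R n (relax_deg T k))
    (degT : (1 <= map_deg T)%N)
    (Xcompact : compact (basic_set g))
    (Xarch : is_archimedean g)
    (F_gtNy : forall z, F z <> -oo%E)
    (F_convex : convex_on_momseq F)
    (F_fin : finitely_determined F)
    (F_lsc : lower_semicontinuous F)
    (y_opt : \forall k \near \oo, R_optimal g F (y k)) :
  [/\ F (extend (y k)) @[k --> \oo] --> P_value T g F,
      exists (phi : nat -> nat)
             (mu : {measure set (borel_rV R n) -> \bar R})
             (ystar : momseq R n),
        [/\ {homo phi : i j / (i < j)%N},
            invariant_measure T g mu,
            attains_P T g F mu,
            is_moment_seq g mu ystar &
            ptws_cvg (fun i => extend (y (phi i))) ystar]
    & forall mu : {measure set (borel_rV R n) -> \bar R},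
        invariant_measure T g mu -> attains_P T g F mu ->
        (forall nu : {measure set (borel_rV R n) -> \bar R},
           invariant_measure T g nu -> attains_P T g F nu ->
           forall A : set (borel_rV R n), measurable A -> nu A = mu A) ->
        exists2 ystar : momseq R n,
          is_moment_seq g mu ystar & ptws_cvg (fun k => extend (y k)) ystar].
Proof.
have limit := ultralimit_invariant degT Xcompact Xarch y_opt.
have optimal := ultralimit_optimal degT Xcompact F_gtNy F_fin F_lsc y_opt.
split; first exact: relaxation_values_cvg.
  have [U [UU infU]] := ultraFilterLemma eventually_filter.
  have [mu [w [mu_inv mu_w wP yw]]] := limit U UU infU.
  have [phi phi_incr phi_cvg] :=
    @ultralimit_subsequence R n (fun k => extend (y k)) w U UU infU yw.
  exists phi, mu, w; split => //.
  by exists w; split => //; exact: (optimal U).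
move=> mu mu_inv [w [mu_w wP Fw]] mu_uniq; exists w => // a.
apply/cvgrPdist_le => e e0; apply: contrapT => nclose.
have [|U [UU infU Ufar]] :=
  @frequently_ultrafilter [set k | e < `|w a - extend (y k) a|].
  by move=> h; apply: nclose; apply: filterS h => k /negP; rewrite -leNgt.
have [nu [v [nu_inv nu_v vP yv]]] := limit U UU infU.
have nu_mu : forall A : set (borel_rV R n), measurable A -> nu A = mu A.
  apply: mu_uniq => //; exists v; split => //; exact: (optimal U).
have vw : v a = w a.
  apply: EFin_inj; rewrite nu_v mu_w.
  by apply: eq_measure_integral => A mA _; exact: nu_mu.
have /cvgrPdist_le/(_ _ e0) := yv a; rewrite vw => Uclose.
have [k [/= h1 h2]] := filter_ex (filterI Ufar Uclose).
by move: h1; rewrite ltNge h2.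
Qed.
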